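(* Let $1<q_0<\infty$ and let $K,L\ge 0$. There exists $\varepsilon=\varepsilon(q_0,K,L)>0$ such that the following holds. Let $(u,b,\pi)$ be a smooth solution of the 2D stationary MHD equations on the entire plane $\mathbb{R}^2$ with $\nabla u\in L^{q_0}(\mathbb{R}^2)$, $\nabla b\in L^\infty(\mathbb{R}^2)$, $\|\nabla u\|_{L^{q_0}(\mathbb{R}^2)}=K$, $\|\nabla b\|_{L^\infty(\mathbb{R}^2)}=L$, and $$\|b\|_{L^1(\mathbb{R}^2)}+\big\||h|^{1/3}\big\|_{L^1(\mathbb{R}^2)}\le\varepsilon.$$ Then $u$ and $\pi$ are constants and $b\equiv 0$.
   Context: The 2D stationary incompressible MHD equations on $\mathbb{R}^2$, for a velocity field $u=(u_1,u_2):\mathbb{R}^2\to\mathbb{R}^2$, a magnetic field $b=(b_1,b_2):\mathbb{R}^2\to\mathbb{R}^2$ and a pressure $\pi:\mathbb{R}^2\to\mathbb{R}$, are $$-\Delta u+u\cdot\nabla u+\nabla\pi=b\cdot\nabla b,\qquad -\Delta b+u\cdot\nabla b=b\cdot\nabla u,\qquad \operatorname{div}u=0,\qquad \operatorname{div}b=0.$$ The function $h$ is defined by $h=\partial_2 b_1-\partial_1 b_2$. *)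

(* Defs.v *)
From HB Require Import structures.
From mathcomp Require Import all_boot all_order all_algebra.
From mathcomp Require Import all_classical all_reals all_analysis.

Set Implicit Arguments.
Unset Strict Implicit.
Unset Printing Implicit Defensive.
Import Order.TTheory GRing.Theory Num.Theory.
Import numFieldNormedType.Exports.

Local Open Scope classical_set_scope.
Local Open Scope ring_scope.

Definition partial1 {R : realType} (f : R * R -> R) : R * R -> R :=
  'D_((1, 0) : R * R) f.
Definition partial2 {R : realType} (f : R * R -> R) : R * R -> R :=
  'D_((0, 1) : R * R) f.

Definition coord1 {R : realType} (v : R * R -> R * R) : R * R -> R :=
  fun x => (v x).1.
Definition coord2 {R : realType} (v : R * R -> R * R) : R * R -> R :=
  fun x => (v x).2.

Fixpoint Ck {R : realType} (k : nat) (f : R * R -> R) : Prop :=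
  match k with
  | 0%N => continuous f
  | k'.+1 =>
      [/\ continuous f,
          forall x, derivable f x ((1, 0) : R * R),
          forall x, derivable f x ((0, 1) : R * R),
          Ck k' (partial1 f)
        & Ck k' (partial2 f)]
  end.

Definition smooth {R : realType} (f : R * R -> R) : Prop :=
  forall k : nat, Ck k f.

Definition smooth_field {R : realType} (v : R * R -> R * R) : Prop :=
  smooth (coord1 v) /\ smooth (coord2 v).

Definition laplacian {R : realType} (f : R * R -> R) : R * R -> R :=
  fun x => partial1 (partial1 f) x + partial2 (partial2 f) x.

Definition divergence {R : realType} (v : R * R -> R * R) : R * R -> R :=
  fun x => partial1 (coord1 v) x + partial2 (coord2 v) x.

(* The scalar operator v . grad. *)
Definition advection {R : realType} (v : R * R -> R * R) (f : R * R -> R) :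
    R * R -> R :=
  fun x => coord1 v x * partial1 f x + coord2 v x * partial2 f x.

Record stationary_MHD {R : realType}
    (u b : R * R -> R * R) (p : R * R -> R) : Prop := {
  momentum1 : forall x,
    - laplacian (coord1 u) x + advection u (coord1 u) x + partial1 p x
    = advection b (coord1 b) x;
  momentum2 : forall x,
    - laplacian (coord2 u) x + advection u (coord2 u) x + partial2 p x
    = advection b (coord2 b) x;
  induction1 : forall x,
    - laplacian (coord1 b) x + advection u (coord1 b) x
    = advection b (coord1 u) x;
  induction2 : forall x,
    - laplacian (coord2 b) x + advection u (coord2 b) x
    = advection b (coord2 u) x;
  div_velocity : forall x, divergence u x = 0;
  div_magnetic : forall x, divergence b x = 0
}.

(* The sign is opposite to the usual scalar curl. *)
Definition current {R : realType} (b : R * R -> R * R) : R * R -> R :=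
  fun x => partial2 (coord1 b) x - partial1 (coord2 b) x.

(* The canonical norm on [R * R] is the sup norm, hence the explicit
   Euclidean (resp. Frobenius) norms. *)
Definition enorm {R : realType} (v : R * R -> R * R) : R * R -> R :=
  fun x => Num.sqrt (coord1 v x ^+ 2 + coord2 v x ^+ 2).

Definition grad_norm {R : realType} (v : R * R -> R * R) : R * R -> R :=
  fun x => Num.sqrt (partial1 (coord1 v) x ^+ 2 + partial2 (coord1 v) x ^+ 2
                     + partial1 (coord2 v) x ^+ 2 + partial2 (coord2 v) x ^+ 2).

Local Open Scope ereal_scope.

Definition lebesgue2 (R : realType) :
    {measure set (measurableTypeR R * measurableTypeR R)%type -> \bar R} :=
  @lebesgue_measure R \x @lebesgue_measure R.

Definition Lpnorm {R : realType} (p : \bar R) (f : R * R -> R) : \bar R :=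
  'N[lebesgue2 R]_p[EFin \o f].

(* Main.v *)
Require Import Defs.
From mathcomp Require Import all_boot all_order all_algebra.
From mathcomp Require Import all_classical all_reals all_analysis.
From mathcomp Require Import lra ring.
Import Order.TTheory GRing.Theory Num.Theory.
Import numFieldNormedType.Exports.

(** The statement follows from two rigidity results for smooth solutions on the
    plane with grad u in L^q0: b vanishes as soon as it is integrable, and then u,
    a stationary flow of the Navier-Stokes equations, is constant.

    Both rest on the slow growth of u. Since 1 < q0, for every delta > 0 there is C
    with t <= delta + C t^q0 for t >= 0, so the integral of |grad u| over a
    rectangle is at most delta times its area plus a constant. Integrating along
    strips of width 1 gives that the integral of |u| over any unit segment inside
    [-n, n]^2 is o(n) ([slow_of_sublinear]).

    Magnetic field. The induction equation is the rotated gradient of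
    u2 b1 - u1 b2 - h, so this quantity is a constant c ([flux_const]). As div b = 0,
    b = (d2 psi, - d1 psi) for a stream function psi, and the identity reads
    u . grad psi - Delta psi = c. On the boundary of a rectangle psi oscillates by at
    most the integral of |b| over that boundary. Since |b| is integrable over the
    plane, the sides can be chosen at distance between n and 2n from the axes with
    these integrals O(1 / n). Up to an additive constant psi is then O(1 / n) on the
    boundary, and since u is divergence free the integrals over the rectangle of
    u . grad psi and of psi (u . grad psi) are boundary terms. The first one, of order
    o(n^2), forces c = 0; the second one shows that the integral of |grad psi|^2 is
    o(1), that is, b = 0 ([rect_flux], [rect_energy], [magnetic_zero]).

    Flow. Now the vorticity w satisfies Delta w = u . grad w and lies in L^q0. Let F be
    a convex function of w. Then N := Delta F - u . grad F = F''(w) |grad w|^2 >= 0.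
    Testing with the square of a cutoff phi of radius n leaves the terms
    F u . grad phi^2 and grad F . grad phi^2. If F'^2 <= K F F'', the second is absorbed
    by the energy and a multiple of F / n^2. For the first, on a unit interval
    phi F is bounded by the integral of phi F and of its derivative, and u integrates to
    o(n) ([strip_bound]); the cutoff contributes 1 / n, so this term is o(1) times the
    energy plus o(1) times the integral of F. Hence N = 0 and F is an integrable
    constant, that is, 0 ([energy_zero]). The function
    F(s) = (1 + s^m)^(q0 / m) - 1, with m an even integer at least q0, is admissible
    and lies below |s|^q0, whence w = 0 ([Liouville]). So u is harmonic, and the same
    theorem without drift, applied to the derivatives of u, makes u constant; the
    momentum equation does the rest. *)

Set Implicit Arguments.
Unset Strict Implicit.
Unset Printing Implicit Defensive.
Local Open Scope classical_set_scope.
Local Open Scope ring_scope.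

(** * Integrals of continuous functions over segments *)

Section Integral1.
Context {R : realType}.
Implicit Types (f g : R -> R) (a b c : R).

Definition intg a b f : R := \int[@lebesgue_measure R]_(x in `[a, b]) f x.

Lemma cont_integrable a b f : continuous f ->
  (@lebesgue_measure R).-integrable `[a, b] (EFin \o f).
Proof.
move=> cf; apply: continuous_compact_integrable; first exact: segment_compact.
exact: continuous_subspaceT.
Qed.

Lemma eq_intg a b f g : (forall x, a <= x <= b -> f x = g x) -> intg a b f = intg a b g.
Proof.
move=> fg; apply: eq_Rintegral => x; rewrite inE/= in_itv/= => H.
exact: fg.
Qed.

Lemma intg_D a b f g : continuous f -> continuous g ->
  intg a b (fun x => f x + g x) = intg a b f + intg a b g.
Proof. by move=> cf cg; rewrite /intg RintegralD //; exact: cont_integrable. Qed.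

Lemma intg_B a b f g : continuous f -> continuous g ->
  intg a b (fun x => f x - g x) = intg a b f - intg a b g.
Proof. by move=> cf cg; rewrite /intg RintegralB //; exact: cont_integrable. Qed.

Lemma intg_Z a b k f : continuous f -> intg a b (fun x => k * f x) = k * intg a b f.
Proof. by move=> cf; rewrite /intg RintegralZl //; exact: cont_integrable. Qed.

Lemma intg_le a b f g : continuous f -> continuous g ->
  (forall x, a <= x <= b -> f x <= g x) -> intg a b f <= intg a b g.
Proof.
move=> cf cg fg; apply: le_Rintegral => //; [exact: cont_integrable|exact: cont_integrable].
Qed.

Lemma intg_ge0 a b f : (forall x, a <= x <= b -> 0 <= f x) -> 0 <= intg a b f.
Proof. by move=> f0; apply: Rintegral_ge0 => x /=; rewrite in_itv/=; exact: f0. Qed.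

Lemma intg_cst a b k : a <= b -> intg a b (fun=> k) = (b - a) * k.
Proof.
move=> ab; rewrite /intg Rintegral_cst//= lebesgue_measure_itv/= lte_fin.
case: ltP => [_|ba]; first by rewrite mulrC.
have -> : a = b by apply/eqP; rewrite eq_le ab ba.
by rewrite subrr mul0r mulr0.
Qed.

Lemma intg_abs a b f : continuous f -> `|intg a b f| <= intg a b (fun x => `|f x|).
Proof. by move=> cf; apply: le_normr_Rintegral => //; exact: cont_integrable. Qed.

Lemma intg_xx a f : intg a a f = 0.
Proof. by rewrite /intg set_itv1 Rintegral_set1. Qed.

Lemma intg_cat a b c f : a <= b <= c -> continuous f ->
  intg a c f = intg a b f + intg b c f.
Proof.
move=> /andP[ab bc] cf.
have i u v : (@lebesgue_measure R).-integrable `[u, v] (EFin \o f) by apply: cont_integrable.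
have := @Rintegral_itvB R f (BLeft a) (BRight c) b (i _ _).
rewrite !bnd_simp => /(_ ab bc)/eqP; rewrite /intg subr_eq addrC => /eqP ->; congr (_ + _).
rewrite Rintegral_itv_obnd_cbnd//.
apply: integrableS (i b c) => //.
by apply: subset_itvr; rewrite bnd_simp.
Qed.

Lemma derive_continuous (F f : R -> R) :
  (forall x, is_derive x (1 : R) F (f x)) -> continuous F.
Proof.
move=> dF x; apply: differentiable_continuous.
by apply/derivable1_diffP; have [] := dF x.
Qed.

Lemma intg_FTC a b f (F : R -> R) : a <= b -> continuous f ->
  (forall x, is_derive x (1 : R) F (f x)) -> intg a b f = F b - F a.
Proof.
rewrite le_eqVlt => /predU1P[-> _ _|ab cf dF].
  by rewrite intg_xx subrr.
have cF := derive_continuous dF.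
rewrite /intg /Rintegral (@continuous_FTC2 _ f F)//.
- exact: continuous_subspaceT.
- split.
  + by move=> x _; have [] := dF x.
  + by apply: cvg_at_right_filter; exact: cF.
  + by apply: cvg_at_left_filter; exact: cF.
- by move=> x _; rewrite derive1E; have [] := dF x.
Qed.

Lemma intg_le_cst a b k f : a <= b -> continuous f ->
  (forall x, a <= x <= b -> f x <= k) -> intg a b f <= (b - a) * k.
Proof.
move=> ab cf fk; rewrite -intg_cst//; apply: intg_le => //; exact: cst_continuous.
Qed.

Lemma intg_ge_cst a b k f : a <= b -> continuous f ->
  (forall x, a <= x <= b -> k <= f x) -> (b - a) * k <= intg a b f.
Proof.
move=> ab cf fk; rewrite -intg_cst//; apply: intg_le => //; exact: cst_continuous.
Qed.

(** By continuity f exceeds half of f x0 on a small segment around x0. *)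
Lemma intg_gt0 a b f x0 : continuous f -> a < x0 < b ->
  (forall x, a <= x <= b -> 0 <= f x) -> 0 < f x0 -> 0 < intg a b f.
Proof.
move=> cf /andP[ax xb] f0 fx0.
have : \forall x \near x0, f x0 / 2 < f x.
  have := cvgr_gt (f x0) (cf x0); apply.
  by rewrite ltr_pdivrMr// ltr_pMr// ltr1n.
have : \forall x \near x0, a < x < b.
  near=> x; apply/andP; split; near: x; [exact: lt_nbhsr | exact: lt_nbhsl].
move=> /filterI/[apply] /nbhs_ballP[e /= e0 He].
pose l := x0 - e / 2; pose r := x0 + e / 2.
have lr : l < r by rewrite /l /r; lra.
have Hin x : l <= x <= r -> (a < x < b) /\ f x0 / 2 < f x.
  move=> /andP[h1 h2]; apply: He; rewrite /ball/= ltr_norml; rewrite /l /r in h1 h2.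
  by apply/andP; split; lra.
have [/andP[al lb] _] := Hin l (ltac:(rewrite lexx ltW//)).
have [/andP[ar rb] _] := Hin r (ltac:(rewrite lexx ltW//)).
rewrite (@intg_cat a l b) ?(ltW al) ?(ltW lb)// (@intg_cat l r b) ?(ltW lr) ?(ltW rb)//.
have h1 : 0 <= intg a l f.
  apply: intg_ge0 => x /andP[? ?]; apply: f0; apply/andP; split=> //.
  by rewrite (le_trans _ (ltW lb)).
have h2 : 0 <= intg r b f.
  apply: intg_ge0 => x /andP[? ?]; apply: f0; apply/andP; split=> //.
  by rewrite (le_trans (ltW ar)).
have h3 : (r - l) * (f x0 / 2) <= intg l r f.
  by apply: intg_ge_cst => //; [exact: ltW | move=> x /Hin[_ /ltW]].
have h4 : 0 < (r - l) * (f x0 / 2) by rewrite mulr_gt0// ?divr_gt0// subr_gt0.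
lra.
Unshelve. all: by end_near. Qed.

(** One of the two integrals is over an empty segment, so this is the signed
    integral from 0 to x and an antiderivative of f on the whole line. *)
Definition prim f (x : R) : R := intg 0 x f - intg x 0 f.

Lemma intg_empty a b f : b < a -> intg a b f = 0.
Proof.
by move=> ba; rewrite /intg set_itv_ge ?Rintegral_set0// bnd_simp -ltNge.
Qed.

(** A base point a to the left of both 0 and x turns the signed integral into
    a difference of integrals over genuine segments, which the fundamental
    theorem of calculus handles. *)
Lemma primE a x f : a <= 0 -> a <= x -> continuous f ->
  prim f x = intg a x f - intg a 0 f.
Proof.
move=> a0 ax cf; rewrite /prim; case: (leP 0 x) => x0.
  rewrite (@intg_cat a 0 x) ?a0// addrAC subrr add0r.
  move: x0; rewrite le_eqVlt => /predU1P[<-|x0]; first by rewrite intg_xx subr0.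
  by rewrite (@intg_empty x 0)// subr0.
rewrite (@intg_cat a x 0) ?ax ?(ltW x0)// opprD addrA subrr.
by rewrite (@intg_empty 0 x).
Qed.

Lemma prim_derive f x : continuous f -> is_derive x (1 : R) (prim f) (f x).
Proof.
move=> cf; pose a := Num.min x 0 - 1.
have ax : a < x by rewrite /a ltrBlDr gt_min ltrDl ltr01.
have a0 : a < 0 by rewrite /a ltrBlDr gt_min add0r ltr01 orbT.
have xx1 : x < x + 1 by rewrite ltrDl.
have [H1 H2] := @continuous_FTC1_closed R f a x (x + 1) xx1
  (cont_integrable a (x + 1) cf) ax (cf x).
apply: (@near_eq_is_derive _ _ _ (fun y => intg a y f - intg a 0 f)).
  near=> y; rewrite (@primE a)// ltW//; near: y; exact: lt_nbhsr.
have h1 : is_derive x (1 : R) (fun y => intg a y f) (f x).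
  by split; [exact: H1 | move: H2; rewrite derive1E].
have := is_deriveB h1 (is_derive_cst (intg a 0 f) x (1 : R)).
by rewrite subr0.
Unshelve. all: by end_near. Qed.

Lemma prim_split f a b : a <= b -> continuous f -> intg a b f = prim f b - prim f a.
Proof. by move=> ab cf; apply: intg_FTC => // x; exact: prim_derive. Qed.

Lemma prim0 f : prim f 0 = 0. Proof. by rewrite /prim intg_xx subrr. Qed.

End Integral1.

(** * Continuity of functions of two variables *)

Section Continuity.
Context {R : realType} {T : topologicalType}.
Implicit Types (f g : T -> R).

Lemma cntD f g : continuous f -> continuous g -> continuous (fun z => f z + g z).
Proof. by move=> cf cg z; apply: cvgD; [exact: cf|exact: cg]. Qed.
Lemma cntB f g : continuous f -> continuous g -> continuous (fun z => f z - g z).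
Proof. by move=> cf cg z; apply: cvgB; [exact: cf|exact: cg]. Qed.
Lemma cntM f g : continuous f -> continuous g -> continuous (fun z => f z * g z).
Proof. by move=> cf cg z; apply: cvgM; [exact: cf|exact: cg]. Qed.
Lemma cntN f : continuous f -> continuous (fun z => - f z).
Proof. by move=> cf z; apply: cvgN; exact: cf. Qed.
Lemma cntA f : continuous f -> continuous (fun z => `|f z|).
Proof. by move=> cf z; apply: cvg_norm; exact: cf. Qed.
Lemma cntC (k : R) : continuous (fun _ : T => k).
Proof. by move=> z; exact: cvg_cst. Qed.
Lemma cntX f n : continuous f -> continuous (fun z => f z ^+ n).
Proof.
move=> cf; elim: n => [|n IH]; first exact: cntC.
rewrite (_ : (fun z => _) = (fun z => f z * f z ^+ n)); first exact: cntM.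
by apply/funext => z; rewrite exprS.
Qed.
Lemma cntO f (g : R -> R) : continuous f -> continuous g -> continuous (fun z => g (f z)).
Proof. by move=> cf cg z; apply: (@continuous_comp _ _ _ f g); [exact: cf|exact: cg]. Qed.
End Continuity.

(** Decomposes a continuity goal along the syntax of the function; the leaves are
    closed by the context. *)
Ltac cnt := lazymatch goal with
  | |- continuous (fun=> ?k) => exact: cntC
  | |- continuous (fun z => @?f z + - @?g z) => apply: (@cntB _ _ f g); cnt
  | |- continuous (fun z => @?f z + @?g z) => apply: (@cntD _ _ f g); cnt
  | |- continuous (fun z => @?f z * @?g z) => apply: (@cntM _ _ f g); cnt
  | |- continuous (fun z => - @?f z) => apply: (@cntN _ _ f); cnt
  | |- continuous (fun z => `|@?f z|) => apply: (@cntA _ _ f); cnt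
  | |- continuous (fun z => @?f z ^+ ?n) => apply: (@cntX _ _ f n); cnt
  | |- continuous _ => first [assumption | by move=> ?; exact: cvg_id | idtac]
  | |- _ => idtac
  end.

Section Slices.
Context {R : realType}.
Implicit Types (f : R * R -> R).

Lemma cnt_slice2 f (x : R) : continuous f -> continuous (fun y => f (x, y)).
Proof.
move=> cf y; refine (@continuous_comp _ _ _ (fun y : R => (x, y)) f y _ (cf _)).
exact: (cvg_pair (cvg_cst x) (@cvg_id _ _)).
Qed.

Lemma cnt_slice1 f (y : R) : continuous f -> continuous (fun x => f (x, y)).
Proof.
move=> cf x; refine (@continuous_comp _ _ _ (fun x : R => (x, y)) f x _ (cf _)).
exact: (cvg_pair (@cvg_id _ _) (cvg_cst y)).
Qed.

Definition swap (z : R * R) := (z.2, z.1).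

Lemma cnt_fst : continuous (fun z : R * R => z.1).
Proof. by move=> z; exact: cvg_fst. Qed.
Lemma cnt_swap f : continuous f -> continuous (fun z => f (swap z)).
Proof.
move=> cf z; refine (@continuous_comp _ _ _ swap f z _ (cf _)).
by case: z => z1 z2; exact: (cvg_pair (@cvg_snd _ _ _ _ _) (@cvg_fst _ _ _ _ _)).
Qed.

Lemma cont_bounded_rect f (a b c d : R) : continuous f ->
  exists M : R, forall x y, a <= x <= b -> c <= y <= d -> `|f (x, y)| <= M.
Proof.
move=> cf.
have K : compact (`[a, b] `*` `[c, d]) by apply: compact_setX; exact: segment_compact.
have /compact_bounded[M [_ H]] := continuous_compact (continuous_subspaceT cf) K.
exists (M + 1) => x y xab ycd; apply: (H (M + 1)); first by rewrite ltrDl.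
by exists (x, y) => //; split => /=; rewrite in_itv.
Qed.

(** Continuity under the integral sign; the dominating function is a bound of f
    on a compact rectangle around the line under consideration. *)
Lemma cnt_intg f (c d : R) : continuous f -> continuous (fun x => intg c d (fun y => f (x, y))).
Proof.
move=> cf x0.
have [M HM] := @cont_bounded_rect f (x0 - 1) (x0 + 1) c d cf.
have := @continuity_under_integral R _ _ (@lebesgue_measure R)
  (fun x y => f (x, y)) `[c, d] (measurable_itv _) (x0 - 1) (x0 + 1) _ _ (fun=> M) _ _ x0.
apply.
- by move=> x _; apply: cont_integrable; exact: cnt_slice2.
- by apply/nearW => y _ x _; exact: cnt_slice1.
- by apply: cont_integrable; exact: cntC.
- move=> x /=; rewrite in_itv/= => /andP[/ltW h1 /ltW h2]; apply/nearW => y /=.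
  by rewrite in_itv/= => H; apply: HM => //; rewrite h1.
- by rewrite inE/= in_itv/= ltrBlDr !ltrDl ltr01.
Qed.

Lemma cnt_intg' f (a b : R) : continuous f -> continuous (fun y => intg a b (fun x => f (x, y))).
Proof. by move=> /cnt_swap /(@cnt_intg _ a b). Qed.

End Slices.

(** * Integrals over rectangles *)

Section Measurability.
Context {R : realType}.

(** The measurable sets of the product are generated by measurable rectangles,
    so an open set has to be recovered as a countable union of rectangles: those
    with rational sides that it contains. *)
Lemma cnt_measurable (f : R * R -> R) : continuous f ->
  measurable_fun setT (f : measurableTypeR R * measurableTypeR R -> measurableTypeR R).
Proof.
move=> cf; apply: (measurability _ (measurable_realfun.RGenOpens.measurableE R)).
move=> _ [_ [a [b ->] <-]]; rewrite setTI.
set O := f @^-1` `]a, b[.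
have oO : open O by apply: open_comp => [z _|]; [exact: cf | exact: interval_open].
pose rect (t : (rat * rat) * (rat * rat)) : set (R * R) :=
  `](ratr t.1.1 : R), (ratr t.1.2 : R)[ `*` `](ratr t.2.1 : R), (ratr t.2.2 : R)[.
have -> : O = \bigcup_t (if `[< rect t `<=` O >] then rect t else set0).
  apply/seteqP; split => [z Oz|z [t _]]; last by case: asboolP => [H /H|_ []].
  have [e /= e0 He] : nbhs_ball z O by apply/nbhs_ballP; exact: open_nbhs_nbhs.
  have lt1 (x : R) : x - e < x by rewrite ltrBlDr ltrDl.
  have lt2 (x : R) : x < x + e by rewrite ltrDl.
  have [q1 /[!in_itv]/= /andP[q11 q12]] := rat_in_itvoo (lt1 z.1).
  have [q2 /[!in_itv]/= /andP[q21 q22]] := rat_in_itvoo (lt2 z.1).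
  have [r1 /[!in_itv]/= /andP[r11 r12]] := rat_in_itvoo (lt1 z.2).
  have [r2 /[!in_itv]/= /andP[r21 r22]] := rat_in_itvoo (lt2 z.2).
  exists ((q1, q2), (r1, r2)) => //; case: asboolP => [_|[]].
    by split => /=; rewrite in_itv/=; apply/andP.
  move=> w [/=]; rewrite !in_itv/= => /andP[w1 w2] /andP[w3 w4]; apply: He.
  by split; rewrite /ball/= ltr_norml; apply/andP; split; lra.
apply: countable_bigcupT_measurable => // t.
by case: asboolP => // _; apply: measurableX; exact: measurable_itv.
Qed.

(** Iterated rather than taken over the product measure, so that the
    one-dimensional results apply in each variable; [intg2_lebesgue] identifies
    it with the Lebesgue integral over the rectangle. *)
Definition intg2 (a b c d : R) (f : R * R -> R) : R :=
  intg a b (fun x => intg c d (fun y => f (x, y))).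

(** Puts both iterated integrals on the whole line, the form in which Tonelli's
    theorem applies. *)
Lemma intg2_iterated (a b c d : R) (f : R * R -> R) : continuous f ->
  ((intg2 a b c d f)%:E =
   \int[@lebesgue_measure R]_x \int[@lebesgue_measure R]_y
     ((f \_ (`[a, b] `*` `[c, d])) (x, y))%:E)%E.
Proof.
move=> cf; rewrite /intg2 /intg /Rintegral fineK.
  rewrite integral_mkcond; apply: eq_integral => x _.
  rewrite patchE; case: ifPn => xab.
    rewrite fineK.
      rewrite [LHS]integral_mkcond; apply: eq_integral => y _.
      rewrite !patchE.
      case: ifPn => yc; case: ifPn => //= xyc; exfalso.
        exact: (negP xyc (mem_set (conj (set_mem xab) (set_mem yc)))).
      by case: (set_mem xyc) => _ /mem_set; rewrite (negbTE yc).
    by apply: integrable_fin_num => //; apply: cont_integrable; exact: cnt_slice2.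
  apply/esym; apply: integral0_eq => y _; rewrite patchE ifF//.
  by apply/negbTE/negP => /set_mem[/mem_set h _]; exact: (negP xab h).
apply: integrable_fin_num => //.
exact: (cont_integrable a b (@cnt_intg R f c d cf)).
Qed.

Lemma measurable_rect_restrict (a b c d : R) (f : R * R -> R) : continuous f ->
  measurable_fun setT
    ((f \_ (`[a, b] `*` `[c, d])) : measurableTypeR R * measurableTypeR R -> measurableTypeR R).
Proof.
move=> cf.
have mR : measurable (`[a, b] `*` `[c, d] : set (measurableTypeR R * measurableTypeR R)).
  by apply: measurableX; exact: measurable_itv.
have [+ _] := @measurable_restrictT _ _ (measurableTypeR R * measurableTypeR R)%type
  (measurableTypeR R) (`[a, b] `*` `[c, d]) f mR; apply.
by apply: measurable_funTS; exact: cnt_measurable.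
Qed.

Lemma intg2_lebesgue (a b c d : R) (f : R * R -> R) : continuous f -> (forall z, 0 <= f z) ->
  ((intg2 a b c d f)%:E = \int[lebesgue2 R]_(z in `[a, b] `*` `[c, d]) (f z)%:E)%E.
Proof.
move=> cf f0.
rewrite integral_mkcond restrict_EFin intg2_iterated// /lebesgue2.
rewrite (@fubini_tonelli1 _ _ _ _ _ _ _
  (fun z : measurableTypeR R * measurableTypeR R => ((f \_ (`[a, b] `*` `[c, d])) z)%:E)) //.
- by apply/measurable_realfun.measurable_EFinP; exact: measurable_rect_restrict.
- by move=> z; rewrite patchE; case: ifP => // _; rewrite lee_fin.
Qed.

Lemma intg2_swap_ge0 (a b c d : R) (f : R * R -> R) : continuous f -> (forall z, 0 <= f z) ->
  intg2 a b c d f = intg2 c d a b (fun z => f (swap z)).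
Proof.
move=> cf f0; apply: EFin_inj.
rewrite (intg2_iterated a b c d cf) (intg2_iterated c d a b (cnt_swap cf)).
have /measurable_realfun.measurable_EFinP mg := measurable_rect_restrict a b c d cf.
have g0 z : (0 <= (EFin \o (f \_ (`[a, b] `*` `[c, d]))) z)%E.
  by rewrite /= patchE; case: ifP => // _; rewrite lee_fin.
apply: (etrans (@fubini_tonelli _ _ _ _ _ (@lebesgue_measure R) (@lebesgue_measure R) _ mg g0)).
apply: eq_integral => y _; apply: eq_integral => x _; rewrite /= !patchE.
case: ifPn => h1; case: ifPn => //= h2; exfalso.
- by apply: (negP h2); apply/mem_set; have [? ?] := set_mem h1; split.
- by apply: (negP h1); apply/mem_set; have [? ?] := set_mem h2; split.
Qed.

End Measurability.

Section Integral2.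
Context {R : realType}.
Implicit Types (f g : R * R -> R) (a b c d : R).

Lemma intg2D a b c d f g : continuous f -> continuous g ->
  intg2 a b c d (fun z => f z + g z) = intg2 a b c d f + intg2 a b c d g.
Proof.
move=> cf cg; rewrite /intg2 -intg_D; [|exact: cnt_intg|exact: cnt_intg].
by apply: eq_intg => x _; rewrite intg_D//; exact: cnt_slice2.
Qed.

Lemma intg2B a b c d f g : continuous f -> continuous g ->
  intg2 a b c d (fun z => f z - g z) = intg2 a b c d f - intg2 a b c d g.
Proof.
move=> cf cg; rewrite /intg2 -intg_B; [|exact: cnt_intg|exact: cnt_intg].
by apply: eq_intg => x _; rewrite intg_B//; exact: cnt_slice2.
Qed.

Lemma intg2Z a b c d k f : continuous f ->
  intg2 a b c d (fun z => k * f z) = k * intg2 a b c d f.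
Proof.
move=> cf; rewrite /intg2 -intg_Z; last exact: cnt_intg.
by apply: eq_intg => x _; rewrite intg_Z//; exact: cnt_slice2.
Qed.

Lemma intg2N a b c d f : continuous f ->
  intg2 a b c d (fun z => - f z) = - intg2 a b c d f.
Proof.
move=> cf; have -> : (fun z => - f z) = (fun z => -1 * f z).
  by apply/funext => z; rewrite mulN1r.
by rewrite (intg2Z a b c d (-1) cf) mulN1r.
Qed.

Lemma intg2_le a b c d f g : continuous f -> continuous g ->
  (forall x y, a <= x <= b -> c <= y <= d -> f (x, y) <= g (x, y)) ->
  intg2 a b c d f <= intg2 a b c d g.
Proof.
move=> cf cg fg; apply: intg_le; [exact: cnt_intg|exact: cnt_intg|] => x xab.
by apply: intg_le; [exact: cnt_slice2|exact: cnt_slice2|] => y; exact: fg.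
Qed.

Lemma eq_intg2 a b c d f g :
  (forall x y, a <= x <= b -> c <= y <= d -> f (x, y) = g (x, y)) ->
  intg2 a b c d f = intg2 a b c d g.
Proof. by move=> fg; apply: eq_intg => x xab; apply: eq_intg => y; exact: fg. Qed.

Lemma intg2_ge0 a b c d f :
  (forall x y, a <= x <= b -> c <= y <= d -> 0 <= f (x, y)) -> 0 <= intg2 a b c d f.
Proof. by move=> f0; apply: intg_ge0 => x xab; apply: intg_ge0 => y; exact: f0. Qed.

Lemma intg2_cst a b c d k : a <= b -> c <= d ->
  intg2 a b c d (fun=> k) = (b - a) * ((d - c) * k).
Proof. by move=> ab cd; rewrite /intg2 intg_cst// intg_cst. Qed.

(** Tonelli's theorem only covers nonnegative functions; f is the difference of
    the continuous nonnegative functions |f| and |f| - f. *)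
Lemma intg2_swap a b c d f : continuous f ->
  intg2 a b c d f = intg2 c d a b (fun z => f (swap z)).
Proof.
move=> cf; pose A (z : R * R) := `|f z|; pose B (z : R * R) := `|f z| - f z.
have cA : continuous A by exact: cntA.
have cB : continuous B by exact: cntB.
have fE : f = (fun z => A z - B z) by apply/funext => z; rewrite /A /B subKr.
rewrite {1}fE (intg2B a b c d cA cB).
rewrite (@intg2_swap_ge0 _ a b c d A cA); last by move=> z; exact: normr_ge0.
rewrite (@intg2_swap_ge0 _ a b c d B cB); last by move=> z; rewrite subr_ge0 ler_norm.
rewrite -(intg2B c d a b (cnt_swap cA) (cnt_swap cB)).
by congr (intg2 c d a b _); apply/funext => z; rewrite [in RHS]fE.
Qed.

Lemma intg2_sub a b c d a' b' c' d' f : continuous f -> (forall z, 0 <= f z) ->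
  a' <= a -> a <= b -> b <= b' -> c' <= c -> c <= d -> d <= d' ->
  intg2 a b c d f <= intg2 a' b' c' d' f.
Proof.
move=> cf f0 aa ab bb cc cd dd.
have sub1 (g : R -> R) u v u' v' : continuous g -> (forall t, 0 <= g t) ->
   u' <= u -> u <= v -> v <= v' -> intg u v g <= intg u' v' g.
  move=> cg g0 h1 h2 h3.
  rewrite (@intg_cat _ u' u v') ?h1 ?(le_trans h2)// (@intg_cat _ u v v') ?h2//.
  have : 0 <= intg u' u g by apply: intg_ge0.
  have : 0 <= intg v v' g by apply: intg_ge0.
  lra.
apply: (@le_trans _ _ (intg2 a b c' d' f)).
  apply: intg_le; [exact: cnt_intg|exact: cnt_intg|] => x _.
  by apply: sub1 => //; exact: cnt_slice2.
apply: sub1 => //; first exact: cnt_intg.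
by move=> x; apply: intg_ge0.
Qed.

Lemma intg2_gt0 a b c d f x0 y0 : continuous f -> a < x0 < b -> c < y0 < d ->
  (forall z, 0 <= f z) -> 0 < f (x0, y0) -> 0 < intg2 a b c d f.
Proof.
move=> cf xab ycd f0 fz; apply: (@intg_gt0 _ a b _ x0) => //; first exact: cnt_intg.
- by move=> x _; apply: intg_ge0.
- by apply: (@intg_gt0 _ c d _ y0) => //; exact: cnt_slice2.
Qed.

End Integral2.

(** * Continuously differentiable functions of two variables *)

Section C1.
Context {R : realType}.
Implicit Types (f g : R * R -> R) (a b c d x y : R).

(** The partial derivatives are data, so that the derivatives of sums, products
    and compositions come out of the lemmas below by unification, and iterating
    the relation expresses higher derivatives. *)
Definition C1 f f1 f2 : Prop :=
  [/\ continuous f, continuous f1, continuous f2,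
      forall x y, is_derive x (1 : R) (fun t => f (t, y)) (f1 (x, y))
    & forall x y, is_derive y (1 : R) (fun t => f (x, t)) (f2 (x, y))].

Lemma C1_swap f f1 f2 : C1 f f1 f2 ->
  C1 (fun z => f (swap z)) (fun z => f2 (swap z)) (fun z => f1 (swap z)).
Proof.
by case=> cf c1 c2 D1 D2; split; try exact: cnt_swap; move=> x y /=; [exact: D2|exact: D1].
Qed.

Lemma C1_eq f f1 f2 g1 g2 : C1 f f1 f2 -> f1 =1 g1 -> f2 =1 g2 -> C1 f g1 g2.
Proof. by move=> H /funext <- /funext <-. Qed.

Lemma C1cst (k : R) : C1 (fun=> k) (fun=> 0) (fun=> 0).
Proof. by split; try exact: cntC; move=> x y; exact: is_derive_cst. Qed.

Lemma C1D f f1 f2 g g1 g2 : C1 f f1 f2 -> C1 g g1 g2 ->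
  C1 (fun z => f z + g z) (fun z => f1 z + g1 z) (fun z => f2 z + g2 z).
Proof.
move=> [? ? ? D1 D2] [? ? ? E1 E2]; split; cnt; move=> x y.
  exact: (is_deriveD (D1 x y) (E1 x y)).
exact: (is_deriveD (D2 x y) (E2 x y)).
Qed.

Lemma C1N f f1 f2 : C1 f f1 f2 ->
  C1 (fun z => - f z) (fun z => - f1 z) (fun z => - f2 z).
Proof.
move=> [? ? ? D1 D2]; split; cnt; move=> x y.
  exact: (is_deriveN (D1 x y)).
exact: (is_deriveN (D2 x y)).
Qed.

Lemma C1B f f1 f2 g g1 g2 : C1 f f1 f2 -> C1 g g1 g2 ->
  C1 (fun z => f z - g z) (fun z => f1 z - g1 z) (fun z => f2 z - g2 z).
Proof. by move=> Hf Hg; exact: (C1D Hf (C1N Hg)). Qed.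

Lemma C1M f f1 f2 g g1 g2 : C1 f f1 f2 -> C1 g g1 g2 ->
  C1 (fun z => f z * g z) (fun z => f1 z * g z + f z * g1 z)
     (fun z => f2 z * g z + f z * g2 z).
Proof.
move=> [? ? ? D1 D2] [? ? ? E1 E2]; split; cnt; move=> x y.
  apply: (is_derive_eq (is_deriveM (D1 x y) (E1 x y))).
  by rewrite /GRing.scale/=; ring.
apply: (is_derive_eq (is_deriveM (D2 x y) (E2 x y))).
by rewrite /GRing.scale/=; ring.
Qed.

Lemma C1comp (h h' : R -> R) f f1 f2 : C1 f f1 f2 -> continuous h' ->
  (forall t, is_derive t (1 : R) h (h' t)) ->
  C1 (fun z => h (f z)) (fun z => h' (f z) * f1 z) (fun z => h' (f z) * f2 z).
Proof.
move=> [? ? ? D1 D2] ch' dh.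
have ch := derive_continuous dh.
split; cnt; try exact: cntO.
  by move=> x y; exact: (is_derive1_comp (dh _) (D1 x y)).
by move=> x y; exact: (is_derive1_comp (dh _) (D2 x y)).
Qed.

Lemma C1fst (h h' : R -> R) : continuous h' ->
  (forall t, is_derive t (1 : R) h (h' t)) ->
  C1 (fun z => h z.1) (fun z => h' z.1) (fun=> 0).
Proof.
move=> ch' dh.
have ch := derive_continuous dh.
split; first exact: (cntO (@cnt_fst R) ch); first exact: (cntO (@cnt_fst R) ch').
- exact: cntC.
- by move=> x y; exact: dh.
- by move=> x y; exact: (is_derive_cst (h x) y (1 : R)).
Qed.

Lemma C1snd (h h' : R -> R) : continuous h' ->
  (forall t, is_derive t (1 : R) h (h' t)) ->
  C1 (fun z => h z.2) (fun=> 0) (fun z => h' z.2).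
Proof. by move=> ch' dh; exact: (C1_swap (C1fst ch' dh)). Qed.

Lemma C1_FTC2 f f1 f2 a b c d : C1 f f1 f2 -> c <= d ->
  intg2 a b c d f2 = intg a b (fun x => f (x, d) - f (x, c)).
Proof.
case=> cf _ cf2 _ D2 cd; apply: eq_intg => x _.
by apply: (@intg_FTC _ _ _ _ (fun t => f (x, t))) => //; exact: cnt_slice2.
Qed.

Lemma C1_FTC1 f f1 f2 a b c d : C1 f f1 f2 -> a <= b ->
  intg2 a b c d f1 = intg c d (fun y => f (b, y) - f (a, y)).
Proof.
move=> Hf ab; rewrite intg2_swap; last by case: Hf.
by rewrite (C1_FTC2 _ _ (C1_swap Hf)).
Qed.

Lemma C1_line1 f f1 f2 a b y : C1 f f1 f2 -> a <= b ->
  intg a b (fun x => f1 (x, y)) = f (b, y) - f (a, y).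
Proof.
by case=> _ cf _ D _ ab; apply: (@intg_FTC _ _ _ _ (fun t => f (t, y))) => //; exact: cnt_slice1.
Qed.

Lemma C1_line2 f f1 f2 x c d : C1 f f1 f2 -> c <= d ->
  intg c d (fun y => f2 (x, y)) = f (x, d) - f (x, c).
Proof.
by case=> _ _ cf _ D cd; apply: (@intg_FTC _ _ _ _ (fun t => f (x, t))) => //; exact: cnt_slice2.
Qed.

(** Where f is nonzero it has constant sign on a small square. *)
Lemma intg2_eq0 f : continuous f ->
  (forall a b c d, a <= b -> c <= d -> intg2 a b c d f = 0) -> forall z, f z = 0.
Proof.
move=> cf H.
have key g : continuous g ->
   (forall a b c d, a <= b -> c <= d -> intg2 a b c d g = 0) -> forall z, 0 < g z -> False.
  move=> cg Hg [x0 y0] g0.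
  have : \forall z \near (x0, y0), 0 < g z by have := cvgr_gt _ (cg (x0, y0)); apply.
  move=> /nbhs_ballP[e /= e0 He].
  have e2 : 0 < e / 2 by rewrite divr_gt0.
  have e2e : e / 2 < e by rewrite ltr_pdivrMr// ltr_pMr// ltr1n.
  have Hin x y : x0 - e / 2 <= x <= x0 + e / 2 -> y0 - e / 2 <= y <= y0 + e / 2 -> 0 < g (x, y).
    move=> /andP[h1 h2] /andP[h3 h4]; apply: He.
    by split; rewrite /ball/= ltr_norml; apply/andP; split; lra.
  have := Hg (x0 - e / 2) (x0 + e / 2) (y0 - e / 2) (y0 + e / 2).
  rewrite !lerD2l ge0_cp ?(ltW e2)// => /(_ isT isT) I0.
  suff : 0 < intg2 (x0 - e / 2) (x0 + e / 2) (y0 - e / 2) (y0 + e / 2) g by rewrite I0 ltxx.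
  apply: (@intg_gt0 _ _ _ _ x0); first exact: cnt_intg.
  - by apply/andP; split; lra.
  - by move=> x hx; apply: intg_ge0 => y hy; apply: ltW; exact: Hin.
  - apply: (@intg_gt0 _ _ _ _ y0); first exact: cnt_slice2.
    + by apply/andP; split; lra.
    + by move=> y hy; apply: ltW; apply: Hin => //; apply/andP; split; lra.
    + exact: g0.
move=> z; case: (ltgtP (f z) 0) => // fz; exfalso.
  apply: (key (fun z => - f z) _ _ z); [exact: cntN| |by rewrite oppr_gt0].
  by move=> a b c d ab cd; rewrite intg2N// H// oppr0.
exact: (key f cf H z).
Qed.

(** Integrating either mixed derivative over a rectangle gives the same
    alternating sum of the values of f at the corners; the difference of the two
    is thus continuous with vanishing integral over every rectangle. *)
Lemma Schwarz f f1 f2 f11 f12 f21 f22 :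
  C1 f f1 f2 -> C1 f1 f11 f12 -> C1 f2 f21 f22 -> f12 =1 f21.
Proof.
move=> H H1 H2 z; apply/eqP; rewrite -subr_eq0; apply/eqP.
have [_ _ c12 _ _] := H1; have [_ c21 _ _ _] := H2; have [_ c1 c2 _ _] := H.
apply: (@intg2_eq0 (fun z => f12 z - f21 z)); first by cnt.
move=> a b c d ab cd; rewrite intg2B// (C1_FTC2 _ _ H1)// (C1_FTC1 _ _ H2)//.
rewrite intg_B; [|exact: cnt_slice1|exact: cnt_slice1].
rewrite intg_B; [|exact: cnt_slice2|exact: cnt_slice2].
rewrite !(C1_line1 _ H)// !(C1_line2 _ H)//; ring.
Qed.

Lemma derivable_slice1 f x y : derivable f (x, y) ((1, 0) : R * R) ->
  is_derive x (1 : R) (fun t => f (t, y)) (partial1 f (x, y)).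
Proof.
(* the two difference quotients agree as functions of the increment *)
have E : (fun h : R => h^-1 *: (f (h *: ((1, 0) : R * R) + (x, y)) - f (x, y))) =
         (fun h : R => h^-1 *: ((fun t => f (t, y)) (h *: (1 : R) + x) - f (x, y))).
  apply/funext => h; congr (_ *: (f _ - _)).
  by apply: injective_projections => //=; rewrite scaler0 add0r.
move=> df; split; first by move: df; rewrite /derivable E.
by rewrite /partial1 /derive E.
Qed.

Lemma derivable_slice2 f x y : derivable f (x, y) ((0, 1) : R * R) ->
  is_derive y (1 : R) (fun t => f (x, t)) (partial2 f (x, y)).
Proof.
have E : (fun h : R => h^-1 *: (f (h *: ((0, 1) : R * R) + (x, y)) - f (x, y))) =
         (fun h : R => h^-1 *: ((fun t => f (x, t)) (h *: (1 : R) + y) - f (x, y))).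
  apply/funext => h; congr (_ *: (f _ - _)).
  by apply: injective_projections => //=; rewrite scaler0 add0r.
move=> df; split; first by move: df; rewrite /derivable E.
by rewrite /partial2 /derive E.
Qed.

(** The directional derivatives along (1, 0) and (0, 1) have the same difference
    quotients as the one-variable derivatives of the slices. *)
Lemma smooth_C1 f : smooth f -> C1 f (partial1 f) (partial2 f).
Proof.
move=> /(_ 1%N) [cf d1 d2 c1 c2]; split => // x y.
  exact/derivable_slice1.
exact/derivable_slice2.
Qed.

Lemma smooth_partial1 f : smooth f -> smooth (partial1 f).
Proof. by move=> sf k; case: (sf k.+1). Qed.

Lemma smooth_partial2 f : smooth f -> smooth (partial2 f).
Proof. by move=> sf k; case: (sf k.+1). Qed.

End C1.

(** * Growth of functions with gradient small in the mean *)

Section Growth.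
Context {R : realType}.
Implicit Types (f g : R * R -> R) (a b c d x y s t : R).

Lemma intg_sub (h : R -> R) a b a' b' : continuous h -> (forall t, 0 <= h t) ->
  a' <= a -> a <= b -> b <= b' -> intg a b h <= intg a' b' h.
Proof.
move=> ch h0 h1 h2 h3.
rewrite (@intg_cat _ a' a b') ?h1 ?(le_trans h2)// (@intg_cat _ a b b') ?h2//.
have k1 : 0 <= intg a' a h by apply: intg_ge0.
have k2 : 0 <= intg b b' h by apply: intg_ge0.
by rewrite addrCA lerDl addr_ge0.
Qed.

Lemma osc_le (h h' : R -> R) a b s t : continuous h' ->
  (forall t, is_derive t (1 : R) h (h' t)) -> a <= s <= b -> a <= t <= b ->
  `|h s - h t| <= intg a b (fun r => `|h' r|).
Proof.
move=> ch dh; wlog ts : s t / t <= s.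
  move=> H hs ht; case/orP: (le_total t s) => ?; first exact: H.
  by rewrite distrC; exact: H.
move=> /andP[as_ sb] /andP[at_ tb].
rewrite -(intg_FTC ts ch dh); apply: (le_trans (intg_abs _ _ ch)).
by apply: intg_sub => //; exact: cntA.
Qed.

Lemma pointwise_le_avg (h h' : R -> R) c y : continuous h' ->
  (forall t, is_derive t (1 : R) h (h' t)) -> c <= y <= c + 1 ->
  h y <= intg c (c + 1) (fun r => h r + `|h' r|).
Proof.
move=> ch' dh hy.
have ch := derive_continuous dh.
have cc : c <= c + 1 by rewrite lerDl.
rewrite intg_D//; last exact: cntA.
rewrite -lerBlDr.
have -> : h y - intg c (c + 1) (fun x => `|h' x|) =
    (c + 1 - c) * (h y - intg c (c + 1) (fun x => `|h' x|)).
  by rewrite addrAC subrr add0r mul1r.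
apply: intg_ge_cst => // t ht; rewrite lerBlDr -lerBlDl.
exact: le_trans (ler_norm _) (osc_le ch' dh hy ht).
Qed.

Lemma strip_sum (h k : R -> R) a (m : nat) : continuous h -> continuous k ->
  (forall j : nat, (j < m)%N ->
    intg (a + j%:R) (a + j%:R + 1) h <= intg (a + j%:R) (a + j%:R + 1) k) ->
  intg a (a + m%:R) h <= intg a (a + m%:R) k.
Proof.
move=> ch ck; elim: m => [|m IH] H; first by rewrite addr0 !intg_xx.
have e : a + m.+1%:R = a + m%:R + 1 by rewrite -addrA natr1.
have l1 : a <= a + m%:R by rewrite lerDl.
have l2 : a + m%:R <= a + m.+1%:R by rewrite e lerDl.
rewrite (@intg_cat _ a (a + m%:R)) ?l1// (@intg_cat _ a (a + m%:R) _ k) ?l1//.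
apply: lerD; first by apply: IH => j jm; apply: H; rewrite ltnW.
by rewrite e; exact: H.
Qed.

(** On a unit interval the supremum of g is at most the integral of g + |g'|,
    so the integral of g h there is at most that integral times the integral of
    h; summing over consecutive unit intervals costs only the uniform bound sg.
    This replaces a Sobolev embedding: h needs no better than an integral bound. *)
Lemma strip_bound (g g' h : R -> R) a (m : nat) (sg : R) :
  continuous g' -> continuous h -> (forall t, is_derive t (1 : R) g (g' t)) ->
  (forall t, a <= t <= a + m%:R -> 0 <= g t) -> (forall t, 0 <= h t) ->
  (forall j : nat, (j < m)%N -> intg (a + j%:R) (a + j%:R + 1) h <= sg) ->
  intg a (a + m%:R) (fun t => g t * h t) <= sg * intg a (a + m%:R) (fun t => g t + `|g' t|).
Proof.
move=> cg' ch dg g0 h0 H.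
have cg := derive_continuous dg.
rewrite -intg_Z; last by cnt.
apply: strip_sum; [by cnt|by cnt|] => j jm.
set c := a + j%:R.
have cc : c <= c + 1 by rewrite lerDl.
have cin t : c <= t <= c + 1 -> a <= t <= a + m%:R.
  move=> /andP[h1 h2]; apply/andP; split; first by rewrite (le_trans _ h1)// lerDl.
  by rewrite (le_trans h2)// /c -addrA lerD2l natr1 ler_nat.
pose A := intg c (c + 1) (fun t => g t + `|g' t|).
have A0 : 0 <= A by apply: intg_ge0 => t /cin/g0 ?; rewrite addr_ge0.
rewrite intg_Z; last by cnt.
apply: (@le_trans _ _ (intg c (c + 1) (fun t => A * h t))).
  apply: intg_le; [by cnt|by apply: cntM; [exact: cntC|]|] => t ht.
  by apply: ler_wpM2r => //; exact: (pointwise_le_avg cg' dg).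
by rewrite intg_Z// mulrC; apply: ler_wpM2r => //; exact: H.
Qed.

(** Growth slower than linear, measured by integrals over unit segments only,
    which is what [strip_bound] asks of the weight. *)
Definition slow f := forall delta : R, 0 < delta -> exists N : nat, forall n : nat, (N <= n)%N ->
  forall x c, `|x| <= n%:R -> - n%:R <= c -> c + 1 <= n%:R ->
  intg c (c + 1) (fun y => `|f (x, y)|) <= delta * n%:R.

(** The property of L^q functions, 1 < q < oo, that the proof exploits: see
    [le_delta_powR] for the pointwise inequality behind it. *)
Definition sublinear f := forall delta : R, 0 < delta -> exists C : R, forall a b c d,
  a <= b -> c <= d -> intg2 a b c d (fun z => `|f z|) <= delta * ((b - a) * (d - c)) + C.

Lemma sublinear_swap f : continuous f -> sublinear f -> sublinear (fun z => f (swap z)).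
Proof.
move=> cf H dl dl0; have [C HC] := H dl dl0; exists C => a b c d ab cd.
rewrite intg2_swap; last exact: (@cnt_swap _ (fun z => `|f z|) (cntA cf)).
rewrite mulrC [(b - a) * _]mulrC mulrC.
have := HC c d a b cd ab; congr (_ <= _); apply: eq_intg2 => x y _ _ //.
Qed.

(** Compare f on the segment {x} x [c, c+1] with its values on [0, 1] x {0}: the
    difference is at most the integral of |f1| over the strip
    [-n, n] x [c, c+1] plus the integral of |f2| over the strip
    [0, 1] x [-n, n]. Both strips have area 2n, so both integrals are o(n). *)
Lemma slow_of_sublinear f f1 f2 : C1 f f1 f2 -> sublinear f1 -> sublinear f2 -> slow f.
Proof.
move=> Hf S1 S2 dl dl0.
have [cf cf1 cf2 D1 D2] := Hf.
have d8 : 0 < dl / 8 by rewrite divr_gt0.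
have [C1 HC1] := S1 _ d8; have [C2 HC2] := S2 _ d8.
pose C0 := intg 0 1 (fun t => `|f (t, 0)|).
(* n >= S makes the constant terms at most delta n / 2. *)
pose S := Num.max 1 (2 * (C0 + C1 + C2) / dl).
exists (Num.bound S) => n Nn x c xn cn1 cn2.
have Sn : S <= n%:R.
  apply: (@le_trans _ _ (Num.bound S)%:R); last by rewrite ler_nat.
  by rewrite ltW// archi_boundP// le_max ler01.
move: Sn; rewrite ge_max ler_pdivrMr// => /andP[n1 nC].
have nn : - n%:R <= n%:R :> R by lra.
have xin : - n%:R <= x <= n%:R by move: xn; rewrite ler_norml.
have cc : c <= c + 1 by rewrite lerDl.
pose P y := intg (- n%:R) n%:R (fun s => `|f1 (s, y)|).
pose Q t := intg (- n%:R) n%:R (fun s => `|f2 (t, s)|).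
have cP : continuous P by apply: (@cnt_intg' _ (fun z => `|f1 z|)); exact: cntA.
have cQ : continuous Q by apply: (@cnt_intg _ (fun z => `|f2 z|)); exact: cntA.
have c0 : continuous (fun t => f (t, 0)) by exact: cnt_slice1.
have pt y t : c <= y <= c + 1 -> 0 <= t <= 1 -> `|f (x, y)| <= (`|f (t, 0)| + Q t) + P y.
  move=> /andP[y1 y2] /andP[t1 t2].
  have h1 : `|f (x, y) - f (t, y)| <= P y.
    apply: (@osc_le (fun s => f (s, y)) (fun s => f1 (s, y))) => //.
    - exact: cnt_slice1.
    - by apply/andP; split; lra.
  have h2 : `|f (t, y) - f (t, 0)| <= Q t.
    apply: (@osc_le (fun s => f (t, s)) (fun s => f2 (t, s))) => //.
    - exact: cnt_slice2.
    - by apply/andP; split; lra.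
    - by apply/andP; split; lra.
  have -> : f (x, y) = f (t, 0) + (f (t, y) - f (t, 0)) + (f (x, y) - f (t, y)) by ring.
  apply: (le_trans (ler_normD _ _)); apply: lerD => //.
  by apply: (le_trans (ler_normD _ _)); apply: lerD.
have pt2 y : c <= y <= c + 1 -> `|f (x, y)| <= (C0 + intg 0 1 Q) + P y.
  move=> hy; rewrite -intg_D//; last exact: cntA.
  rewrite -lerBlDr.
  have -> : `|f (x, y)| - P y = (1 - 0) * (`|f (x, y)| - P y) by rewrite subr0 mul1r.
  apply: intg_ge_cst => //; first by apply: cntD => //; exact: cntA.
  by move=> t ht; rewrite lerBlDr; exact: pt.
have -> : dl * n%:R = dl / 2 * n%:R + dl / 2 * n%:R by lra.
have cfx : continuous (fun y => f (x, y)) by exact: cnt_slice2.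
apply: (@le_trans _ _ (intg c (c + 1) (fun y => (C0 + intg 0 1 Q) + P y))).
  apply: intg_le => //; [exact: cntA|by apply: cntD => //; exact: cntC].
rewrite intg_D//; last exact: cntC.
rewrite intg_cst// addrAC subrr add0r mul1r.
have b1 : intg c (c + 1) P <= dl / 8 * (n%:R - - n%:R) + C1.
  have -> : intg c (c + 1) P = intg2 (- n%:R) n%:R c (c + 1) (fun z => `|f1 z|).
    by rewrite intg2_swap//; exact: cntA.
  by apply: (le_trans (HC1 _ _ _ _ nn cc)); rewrite [c + 1]addrC addrK mulr1.
have b2 : intg 0 1 Q <= dl / 8 * (n%:R - - n%:R) + C2.
  have -> : intg 0 1 Q = intg2 0 1 (- n%:R) n%:R (fun z => `|f2 z|) by [].
  by apply: (le_trans (HC2 _ _ _ _ ler01 nn)); rewrite subr0 mul1r.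
lra.
Qed.

(** Sum of 2n unit segments. *)
Lemma slow_segment f : continuous f -> slow f -> forall delta : R, 0 < delta ->
  exists N : nat, forall n : nat, (N <= n)%N -> forall x, `|x| <= n%:R ->
  intg (- n%:R) n%:R (fun y => `|f (x, y)|) <= delta * n%:R ^+ 2.
Proof.
move=> cf sf dl dl0; have d2 : 0 < dl / 2 by rewrite divr_gt0.
have [N HN] := sf _ d2; exists N => n Nn x xn.
have e : n%:R = - n%:R + (n + n)%:R :> R by rewrite natrD; lra.
have ca : continuous (fun y => `|f (x, y)|) by apply: cntA; exact: cnt_slice2.
rewrite {2}e; apply: (@le_trans _ _ (intg (- n%:R) (- n%:R + (n + n)%:R) (fun=> dl / 2 * n%:R))).
  apply: strip_sum => //; first exact: cntC.
  move=> j jn; rewrite intg_cst ?lerDl// (_ : _ - _ = 1) ?mul1r; last by ring.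
  apply: HN => //; first by rewrite lerDl.
  have : (j.+1)%:R <= (n + n)%:R :> R by rewrite ler_nat.
  by rewrite -natr1 natrD; lra.
rewrite intg_cst -?e; last by rewrite ge0_cp.
by rewrite expr2; lra.
Qed.

End Growth.

(** * Energy estimate for subsolutions of a drift-diffusion equation *)

Section Algebra.
Context {R : realType}.
Implicit Types (A B x k K : R).

Lemma amgm_abs A B x : 0 <= A -> 0 <= B -> x ^+ 2 <= 4 * (A * B) -> `|x| <= A + B.
Proof.
move=> A0 B0 H; rewrite -(@ler_pXn2r _ 2) ?nnegrE ?addr_ge0// real_normK ?num_real//.
apply: (le_trans H); rewrite -subr_ge0.
have -> : (A + B) ^+ 2 - 4 * (A * B) = (A - B) ^+ 2 by ring.
exact: sqr_ge0.
Qed.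

(** Part of the energy is absorbed: the term with the gradient of the cutoff is
    split by the arithmetic-geometric mean inequality. *)
Lemma cutoff_grad_le (phi phi1 F F1 N K k : R) : 0 <= phi -> `|phi1| <= 2 * k ->
  0 <= F -> 0 <= N -> 0 <= K -> F1 ^+ 2 <= K * (F * N) ->
  - (2 * phi * phi1 * F1) <= phi ^+ 2 * N / 8 + 32 * K * k ^+ 2 * F.
Proof.
move=> phi0 hphi1 F0 N0 K0 H.
have k0 : 0 <= k by rewrite -(@pmulr_rge0 _ 2)//; exact: le_trans hphi1.
apply: le_trans (ler_norm _) _; rewrite normrN; apply: amgm_abs.
- by rewrite divr_ge0// mulr_ge0// sqr_ge0.
- by rewrite !mulr_ge0// sqr_ge0.
have -> : (2 * phi * phi1 * F1) ^+ 2 = (4 * phi ^+ 2 * F1 ^+ 2) * `|phi1| ^+ 2.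
  by rewrite real_normK ?num_real//; ring.
have -> : 4 * (phi ^+ 2 * N / 8 * (32 * K * k ^+ 2 * F)) =
   4 * phi ^+ 2 * (K * (F * N)) * (2 * k) ^+ 2 by field.
apply: ler_pM.
- by apply: mulr_ge0; [apply: mulr_ge0 => //|]; exact: sqr_ge0.
- exact: sqr_ge0.
- by apply: ler_wpM2l => //; rewrite mulr_ge0// sqr_ge0.
- by rewrite ler_pXn2r ?nnegrE// mulr_ge0.
Qed.

(** Here phi is the cutoff, N the energy density and k the inverse of the radius.
    A quarter of the energy appears on the right and is absorbed later. *)
Lemma energy_pointwise (phi phi1 phi2 F F1 F2 N p q K k : R) :
  0 <= phi -> `|phi1| <= 2 * k -> `|phi2| <= 2 * k ->
  0 <= F -> 0 <= N -> 0 <= K -> F1 ^+ 2 <= K * (F * N) -> F2 ^+ 2 <= K * (F * N) ->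
  F * (p * (2 * phi * phi1) + q * (2 * phi * phi2))
    - (2 * phi * phi1 * F1 + 2 * phi * phi2 * F2)
  <= phi ^+ 2 * N / 4 + 64 * K * k ^+ 2 * F
     + 4 * k * (phi * F * `|p| + phi * F * `|q|).
Proof.
move=> phi0 h1 h2 F0 N0 K0 H1 H2.
have e1 := cutoff_grad_le phi0 h1 F0 N0 K0 H1.
have e2 := cutoff_grad_le phi0 h2 F0 N0 K0 H2.
have key (r s : R) : `|s| <= 2 * k -> F * (r * (2 * phi * s)) <= 4 * k * (phi * F * `|r|).
  move=> hs; have -> : F * (r * (2 * phi * s)) = 2 * phi * F * (r * s) by ring.
  have -> : 4 * k * (phi * F * `|r|) = 2 * phi * F * (`|r| * (2 * k)) by ring.
  apply: ler_wpM2l; first by rewrite !mulr_ge0.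
  by apply: (le_trans (ler_norm _)); rewrite normrM ler_wpM2l.
have := key p _ h1; have := key q _ h2; lra.
Qed.

(** Bounds the derivative of phi * F, the function to which [strip_bound] is
    applied. *)
Lemma strip_pointwise (phi phi2 F F2 N K k : R) : 0 <= phi -> `|phi2| <= 2 * k -> k <= 1 ->
  0 <= F -> 0 <= N -> 0 <= K -> F2 ^+ 2 <= K * (F * N) ->
  `|phi2 * F + phi * F2| <= phi ^+ 2 * N + (2 + K / 4) * F.
Proof.
move=> phi0 h2 k1 F0 N0 K0 H; apply: (le_trans (ler_normD _ _)).
have e1 : `|phi2 * F| <= 2 * F.
  rewrite normrM (ger0_norm F0); apply: ler_wpM2r => //; apply: (le_trans h2).
  by rewrite ger_pMr.
have e2 : `|phi * F2| <= phi ^+ 2 * N + K / 4 * F.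
  apply: amgm_abs; first by apply: mulr_ge0 => //; exact: sqr_ge0.
      by apply: mulr_ge0 => //; apply: divr_ge0.
  have -> : (phi * F2) ^+ 2 = phi ^+ 2 * F2 ^+ 2 by ring.
  have -> : 4 * (phi ^+ 2 * N * (K / 4 * F)) = phi ^+ 2 * (K * (F * N)) by field.
  by rewrite ler_wpM2l// sqr_ge0.
lra.
Qed.
End Algebra.

Section Cutoff.
Context {R : realType} (n : R) (n1 : 1 <= n).

(** A polynomial cutoff: since every integral is over [-n, n]^2, vanishing on the
    boundary of that square suffices. *)
Definition eta (t : R) := 1 - (t / n) ^+ 2.
Definition eta' (t : R) := - (2 * t / n ^+ 2).

Lemma eta_deriv (t : R) : is_derive t (1 : R) eta (eta' t).
Proof.
have H := is_deriveX 2 (is_deriveM (is_derive_id t (1 : R)) (is_derive_cst n^-1 t (1 : R))).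
have := is_deriveB (is_derive_cst (1 : R) t (1 : R)) H.
move=> /is_derive_eq; apply.
rewrite /eta' /GRing.scale/= -exprVn expr1.
by change (0 - 2 * (t * n^-1) * (t * 0 + n^-1 * 1) = - (2 * t * n^-1 ^+ 2)); ring.
Qed.

Lemma cnt_eta' : continuous eta'.
Proof. change (continuous (fun t : R => - (2 * t / n ^+ 2))); cnt. Qed.

Let n0 : 0 < n. Proof. exact: lt_le_trans n1. Qed.

Lemma eta_bnd (t : R) : `|t| <= n -> 0 <= eta t <= 1.
Proof.
move=> tn; rewrite /eta subr_ge0 lerBlDr lerDl sqr_ge0 andbT.
rewrite -real_normK ?num_real// -[leRHS](expr1n _ 2) ler_pXn2r ?nnegrE//.
by rewrite normrM normfV (gtr0_norm n0) ler_pdivrMr// mul1r.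
Qed.

Lemma eta_lb (t : R) : `|t| <= n / 2 -> 3 / 4 <= eta t.
Proof.
move=> tn; rewrite /eta.
suff : (t / n) ^+ 2 <= (1 / 2) ^+ 2 by rewrite !expr2; lra.
rewrite -real_normK ?num_real// ler_pXn2r ?nnegrE//.
by rewrite normrM normfV (gtr0_norm n0) ler_pdivrMr// mulrC mul1r.
Qed.

Lemma eta'_bnd (t : R) : `|t| <= n -> `|eta' t| <= 2 * n^-1.
Proof.
move=> tn; rewrite /eta' normrN normrM normfV (ger0_norm (sqr_ge0 _)) normrM ger0_norm//.
rewrite -mulrA ler_wpM2l// ler_pdivrMr ?exprn_gt0// expr2 mulrA mulVf ?mul1r//.
by rewrite gt_eqF.
Qed.

Lemma eta_n : eta n = 0.
Proof. by rewrite /eta divff ?gt_eqF// expr1n subrr. Qed.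
Lemma eta_Nn : eta (- n) = 0.
Proof. by rewrite /eta mulNr sqrrN divff ?gt_eqF// expr1n subrr. Qed.

Definition phi (z : R * R) := eta z.1 * eta z.2.
Definition phi1 (z : R * R) := eta' z.1 * eta z.2.
Definition phi2 (z : R * R) := eta z.1 * eta' z.2.

Lemma C1phi : C1 phi phi1 phi2.
Proof.
apply: (C1_eq (C1M (C1fst cnt_eta' eta_deriv) (C1snd cnt_eta' eta_deriv))) => z.
  by rewrite /phi1 mulr0 addr0.
by rewrite /phi2 mul0r add0r.
Qed.

Lemma phi_bnd x y : `|x| <= n -> `|y| <= n -> 0 <= phi (x, y) <= 1.
Proof.
move=> /eta_bnd/andP[a1 a2] /eta_bnd/andP[b1 b2]; rewrite /phi/= mulr_ge0//=.
by rewrite mulr_ile1.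
Qed.

Lemma phi1_bnd x y : `|x| <= n -> `|y| <= n -> `|phi1 (x, y)| <= 2 * n^-1.
Proof.
move=> /eta'_bnd a /eta_bnd/andP[b1 b2]; rewrite /phi1/= normrM (ger0_norm b1).
by rewrite -[leRHS]mulr1 ler_pM.
Qed.

Lemma phi2_bnd x y : `|x| <= n -> `|y| <= n -> `|phi2 (x, y)| <= 2 * n^-1.
Proof.
move=> /eta_bnd/andP[b1 b2] /eta'_bnd a; rewrite /phi2/= normrM (ger0_norm b1).
by rewrite -[leRHS]mul1r ler_pM.
Qed.

Lemma phi_lb x y : `|x| <= n / 2 -> `|y| <= n / 2 -> 1 / 4 <= phi (x, y) ^+ 2.
Proof.
move=> /eta_lb a /eta_lb b; rewrite /phi/=.
have h : 9 / 16 <= eta x * eta y.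
  have -> : 9 / 16 = (3 / 4) * (3 / 4) :> R by field.
  by apply: ler_pM => //; lra.
have h2 : (9 / 16) ^+ 2 <= (eta x * eta y) ^+ 2.
  by rewrite ler_pXn2r ?nnegrE//; lra.
by apply: le_trans h2; lra.
Qed.

Lemma phi_bdry z : (z.1 = n \/ z.1 = - n \/ z.2 = n \/ z.2 = - n) -> phi z = 0.
Proof.
by rewrite /phi => -[->|[->|[->|->]]]; rewrite ?eta_n ?eta_Nn ?mul0r ?mulr0.
Qed.

(** The divergence theorem when the cutoff is a factor of the field, so that no
    boundary term is left. *)
Lemma intg2_div0 f f1 f2 g g1 g2 : C1 f f1 f2 -> C1 g g1 g2 ->
  (forall z, phi z = 0 -> f z = 0) -> (forall z, phi z = 0 -> g z = 0) ->
  intg2 (- n) n (- n) n (fun z => f1 z + g2 z) = 0.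
Proof.
move=> Hf Hg f0 g0; have nn : - n <= n by rewrite ge0_cp// ltW.
have [_ c1 _ _ _] := Hf; have [_ _ c2 _ _] := Hg.
rewrite intg2D// (C1_FTC1 _ _ Hf nn) (C1_FTC2 _ _ Hg nn).
rewrite (@eq_intg _ _ _ _ (fun=> 0)); last first.
  by move=> y _; rewrite !f0 ?subr0//; apply: phi_bdry => /=; tauto.
rewrite (@eq_intg _ _ _ (fun x => g (x, n) - g (x, - n)) (fun=> 0)); last first.
  by move=> y _; rewrite !g0 ?subr0//; apply: phi_bdry => /=; tauto.
by rewrite !intg_cst// mulr0 addr0.
Qed.
End Cutoff.

Lemma energy_arith {R : realType} (X Ip Iq k n delta K M : R) : 0 <= X ->
  0 <= k -> k * n = 1 -> k <= delta -> 0 <= delta -> delta <= 1 / 32 -> 0 <= K -> 0 <= M ->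
  X <= X / 4 + 64 * K * k ^+ 2 * M + 4 * k * (Ip + Iq) ->
  Ip <= delta * n * (X + (3 + K / 4) * M) ->
  Iq <= delta * n * (X + (3 + K / 4) * M) ->
  X <= 2 * delta * M * (66 * K + 24).
Proof.
move=> X0 k0 kn kd d0 d1 K0 M0 HX hp hq.
have red S T : S <= delta * n * T -> k * S <= delta * T.
  move=> /(ler_wpM2l k0) /le_trans; apply.
  have -> : k * (delta * n * T) = (k * n) * (delta * T) by ring.
  by rewrite kn mul1r.
have {}hp := red _ _ hp; have {}hq := red _ _ hq.
have hk : K * M * k ^+ 2 <= K * M * delta.
  apply: ler_wpM2l; first exact: mulr_ge0.
  rewrite expr2; apply: (le_trans _ kd); apply: ler_piMl => //; lra.
have hX : delta * X <= 1 / 32 * X by exact: ler_wpM2r.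
have e1 : delta * (X + (3 + K / 4) * M) = delta * X + 3 * (delta * M) + K * M * delta / 4 by field.
rewrite e1 in hp hq.
have e2 : 2 * delta * M * (66 * K + 24) = 132 * (K * M * delta) + 48 * (delta * M) by ring.
have e3 : 64 * K * k ^+ 2 * M = 64 * (K * M * k ^+ 2) by ring.
have e4 : 4 * k * (Ip + Iq) = 4 * (k * Ip) + 4 * (k * Iq) by ring.
rewrite e2; rewrite e3 e4 in HX.
clear -hk hp hq hX HX X0; lra.
Qed.

Section Energy.
Context {R : realType}.
Variables (p p1 p2 q q1 q2 F F1 F2 F11 F12 F21 F22 : R * R -> R).
Variables (K M : R).
Hypotheses (Hp : C1 p p1 p2) (Hq : C1 q q1 q2) (divpq : forall z, p1 z + q2 z = 0).
Hypotheses (HF : C1 F F1 F2) (HF1 : C1 F1 F11 F12) (HF2 : C1 F2 F21 F22).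
Let N z := F11 z + F22 z - (p z * F1 z + q z * F2 z).
Hypotheses (F0 : forall z, 0 <= F z) (N0 : forall z, 0 <= N z) (K0 : 0 <= K).
Hypotheses (KF1 : forall z, F1 z ^+ 2 <= K * (F z * N z))
           (KF2 : forall z, F2 z ^+ 2 <= K * (F z * N z)).
Hypothesis intF : forall n : nat, intg2 (- n%:R) n%:R (- n%:R) n%:R F <= M.

Let cF : continuous F. Proof. by case: HF. Qed.
Let cF1 : continuous F1. Proof. by case: HF1. Qed.
Let cF2 : continuous F2. Proof. by case: HF2. Qed.
Let cF11 : continuous F11. Proof. by case: HF1. Qed.
Let cF22 : continuous F22. Proof. by case: HF2. Qed.
Let cp : continuous p. Proof. by case: Hp. Qed.
Let cq : continuous q. Proof. by case: Hq. Qed.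
Let cN : continuous N. Proof. by rewrite /N; cnt. Qed.

(** Divergence theorem for phi^2 (grad F - F (p, q)), which vanishes on the
    boundary of the square; (p, q) is divergence free. *)
Lemma energy_identity (n : R) : 1 <= n ->
  intg2 (- n) n (- n) n (fun z => phi n z ^+ 2 * N z) =
  intg2 (- n) n (- n) n (fun z =>
    F z * (p z * (2 * phi n z * phi1 n z) + q z * (2 * phi n z * phi2 n z))
    - (2 * phi n z * phi1 n z * F1 z + 2 * phi n z * phi2 n z * F2 z)).
Proof.
move=> n1; have Hphi := C1phi n; have HPhi := C1M Hphi Hphi.
have [cphi cphi1 cphi2 _ _] := Hphi.
have HA := C1M HPhi (C1B HF1 (C1M Hp HF)).
have HB := C1M HPhi (C1B HF2 (C1M Hq HF)).
have := intg2_div0 n1 HA HB.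
move=> H; apply/eqP; rewrite -subr_eq0 -intg2B; [|by cnt|by cnt].
rewrite -[X in _ == X]H; last 2 first.
- by move=> z ->; rewrite mul0r mul0r.
- by move=> z ->; rewrite mul0r mul0r.
apply/eqP; apply: eq_intg2 => x y _ _; rewrite /N.
have -> : q2 (x, y) = - p1 (x, y) by apply/eqP; rewrite -addr_eq0 addrC divpq.
ring.
Qed.

(** The drift r, of size o(n) on unit segments, is integrated against phi F with
    [strip_bound]. The derivative of phi F this costs is controlled by the
    energy itself, hence the term which [energy_decay] absorbs. *)
Lemma strip_drift (r : R * R -> R) (delta : R) (n : nat) : continuous r -> (0 < n)%N -> 0 < delta ->
  (forall x c : R, `|x| <= n%:R -> - n%:R <= c -> c + 1 <= n%:R ->
    intg c (c + 1) (fun y => `|r (x, y)|) <= delta * n%:R) ->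
  intg2 (- n%:R) n%:R (- n%:R) n%:R (fun z => phi n%:R z * F z * `|r z|) <=
  delta * n%:R * (intg2 (- n%:R) n%:R (- n%:R) n%:R (fun z => phi n%:R z ^+ 2 * N z)
     + (3 + K / 4) * M).
Proof.
move=> cr n0 dl0 H.
have n1 : (1 : R) <= n%:R by rewrite ler1n.
have Hphi := C1phi (n%:R : R); have [cphi cphi1 cphi2 _ _] := Hphi.
have HA := C1M Hphi HF; have [cA _ cA2 _ dA2] := HA.
have nn : - n%:R <= n%:R :> R by rewrite ge0_cp.
have e : n%:R = - n%:R + (n + n)%:R :> R by rewrite natrD addKr.
pose A z := phi n%:R z * F z.
pose A2 z := phi2 n%:R z * F z + phi n%:R z * F2 z.
apply: (@le_trans _ _ (intg2 (- n%:R) n%:R (- n%:R) n%:R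
   (fun z => delta * n%:R * (A z + `|A2 z|)))).
  apply: intg_le; first by apply: (@cnt_intg _ (fun z => phi n%:R z * F z * `|r z|)); cnt.
    by apply: (@cnt_intg _ (fun z => delta * n%:R * (A z + `|A2 z|))); cnt.
  move=> x; rewrite -ler_norml => xn.
  rewrite intg_Z; last first.
    by apply: (@cnt_slice2 _ (fun z => A z + `|A2 z|)); cnt.
  have eI (G : R -> R) : intg (- n%:R) n%:R G = intg (- n%:R) (- n%:R + (n + n)%:R) G by rewrite -e.
  rewrite 2!eI.
  apply: (@strip_bound _ (fun y => A (x, y)) (fun y => A2 (x, y)) (fun y => `|r (x, y)|)).
  - exact: cnt_slice2.
  - by apply: cntA; exact: cnt_slice2.
  - rewrite -e => y; rewrite -ler_norml => yn.
    by rewrite mulr_ge0//; have /andP[] := phi_bnd n1 xn yn.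
  - by [].
  - move=> j jn; apply: H => //; first by rewrite lerDl.
    have : (j.+1)%:R <= (n + n)%:R :> R by rewrite ler_nat.
    by rewrite -natr1 natrD; lra.
rewrite intg2Z; last by cnt.
apply: ler_wpM2l; first by rewrite mulr_ge0// ltW.
apply: (@le_trans _ _ (intg2 (- n%:R) n%:R (- n%:R) n%:R
   (fun z => phi n%:R z ^+ 2 * N z + (3 + K / 4) * F z))).
  apply: intg2_le; [by cnt|by cnt|] => x y; rewrite -!ler_norml => xn yn.
  have /andP[phi0 phi1] := phi_bnd n1 xn yn.
  have k1 : (n%:R^-1 : R) <= 1 by rewrite invf_le1// (lt_le_trans ltr01 n1).
  have := strip_pointwise phi0 (phi2_bnd n1 xn yn) k1 (F0 (x, y)) (N0 (x, y)) K0 (KF2 (x, y)).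
  have : A (x, y) <= F (x, y) by rewrite /A ler_piMl.
  by rewrite /A2; lra.
rewrite intg2D; [|by cnt|by cnt].
rewrite lerD2l intg2Z//; apply: ler_wpM2l => //.
by rewrite addr_ge0// divr_ge0.
Qed.

Hypotheses (Sp : slow p) (Sq : slow q).

(** The cutoff contributes a factor 1 / n and the drift a factor delta * n, so
    their product is of order delta; for delta at most 1 / 32 at most half of the
    energy is on the right. *)
Lemma energy_decay (delta : R) : 0 < delta -> delta <= 1 / 32 ->
  exists n0 : nat, forall n : nat, (n0 <= n)%N ->
  intg2 (- n%:R) n%:R (- n%:R) n%:R (fun z => phi n%:R z ^+ 2 * N z) <=
  2 * delta * M * (66 * K + 24).
Proof.
move=> dl0 dl1; have [n1 H1] := Sp dl0; have [n2 H2] := Sq dl0.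
exists (maxn 1 (maxn (maxn n1 n2) (Num.bound delta^-1))) => n.
rewrite !geq_max => /and3P[n_1 /andP[/H1 Dp /H2 Dq] nb].
have n_1R : (1 : R) <= n%:R by rewrite ler1n.
have nb' : n%:R^-1 <= delta.
  rewrite invf_ple ?posrE// ?(lt_le_trans _ n_1R)//.
  apply: (@le_trans _ _ (Num.bound delta^-1)%:R); last by rewrite ler_nat.
  by rewrite ltW// archi_boundP// invr_ge0 ltW.
set X := intg2 _ _ _ _ _.
have Xp := strip_drift cp n_1 dl0 Dp.
have Xq := strip_drift cq n_1 dl0 Dq.
have XE : X = _ := energy_identity n_1R.
have Hphi := C1phi (n%:R : R); have [cphi cphi1 cphi2 _ _] := Hphi.
set k := (n%:R^-1 : R) in nb'.
have k0 : 0 <= k by rewrite invr_ge0 ler0n.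
have kn : k * n%:R = 1 by rewrite mulVf// pnatr_eq0 -lt0n.
have M0 : 0 <= M by apply: le_trans (intF 0); apply: intg2_ge0.
have : X <= X / 4 + 64 * K * k ^+ 2 * M
   + 4 * k * (intg2 (- n%:R) n%:R (- n%:R) n%:R (fun z => phi n%:R z * F z * `|p z|)
    + intg2 (- n%:R) n%:R (- n%:R) n%:R (fun z => phi n%:R z * F z * `|q z|)).
  apply: (@le_trans _ _ (intg2 (- n%:R) n%:R (- n%:R) n%:R (fun z =>
    (4^-1 * (phi n%:R z ^+ 2 * N z) + 64 * K * k ^+ 2 * F z)
     + 4 * k * (phi n%:R z * F z * `|p z| + phi n%:R z * F z * `|q z|)))).
    rewrite XE; apply: intg2_le; [by cnt|by cnt|] => x y; rewrite -!ler_norml => xn yn.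
    have /andP[phi0 phi1] := phi_bnd n_1R xn yn.
    rewrite [4^-1 * _]mulrC.
    exact: (energy_pointwise (p (x, y)) (q (x, y)) phi0 (phi1_bnd n_1R xn yn) (phi2_bnd n_1R xn yn)
      (F0 _) (N0 _) K0 (KF1 _) (KF2 _)).
  rewrite intg2D; [|by cnt|by cnt].
  rewrite intg2D; [|by cnt|by cnt].
  rewrite (@intg2Z _ _ _ _ _ 4^-1); last by cnt.
  rewrite (@intg2Z _ _ _ _ _ (64 * K * k ^+ 2)); last by cnt.
  rewrite (@intg2Z _ _ _ _ _ (4 * k)); last by cnt.
  rewrite intg2D; [|by cnt|by cnt].
  apply: lerD => //; apply: lerD; first by rewrite mulrC.
  by apply: ler_wpM2l => //; apply: mulr_ge0; [apply: mulr_ge0|exact: sqr_ge0].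
move=> HX; apply: (energy_arith _ k0 kn nb' (ltW dl0) dl1 K0 M0 HX Xp Xq).
by apply: intg2_ge0 => x y _ _; apply: mulr_ge0 => //; exact: sqr_ge0.
Qed.

(** The energy over a fixed square is at most four times the energy weighted by
    the squared cutoff of a square at least twice as large, which is arbitrarily
    small. *)
Lemma energy_vanish z : N z = 0.
Proof.
apply/eqP; rewrite eq_le N0 andbT leNgt; apply/negP; case: z => x y Nz.
have M0 : 0 <= M by apply: le_trans (intF 0); apply: intg2_ge0.
pose m := Num.bound (Num.max `|x| `|y|).
have : Num.max `|x| `|y| < m%:R by rewrite archi_boundP// le_max normr_ge0.
rewrite gt_max => /andP[]; rewrite !ltr_norml => xm ym.
have J0 : 0 < intg2 (- m%:R) m%:R (- m%:R) m%:R N by apply: (intg2_gt0 cN xm ym N0).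
set J := intg2 _ _ _ _ _ in J0.
(* [energy_decay] bounds the weighted energy by delta B / 4. *)
pose B := 8 * M * (66 * K + 24).
have B0 : 0 <= B by rewrite !mulr_ge0// addr_ge0// mulr_ge0.
have B1 : 0 < B + 1 by rewrite ltr_wpDl.
pose dl := Num.min (1 / 32) (J / (B + 1)).
have dl0 : 0 < dl by rewrite lt_min divr_gt0//= divr_gt0.
have dl1 : dl <= 1 / 32 by rewrite ge_min lexx.
have dlB : dl * B < J.
  apply: (@lt_le_trans _ _ (dl * (B + 1))); first by rewrite ltr_pM2l// ltrDl.
  by rewrite -ler_pdivlMr// ge_min lexx orbT.
have [n0 H] := energy_decay dl0 dl1.
pose n := maxn n0 (maxn 1 (m + m)).
have := H n (leq_maxl _ _); rewrite leNgt => /negP; apply.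
have n_1 : (1 : R) <= n%:R by rewrite ler1n /n !leq_max /= orbT.
have mn : (m + m)%:R <= n%:R :> R by rewrite ler_nat /n !leq_max leqnn !orbT.
have [cphi _ _ _ _] := C1phi (n%:R : R).
have m0 : 0 <= m%:R :> R by [].
rewrite natrD in mn.
have h1 : intg2 (- m%:R) m%:R (- m%:R) m%:R (fun z => phi n%:R z ^+ 2 * N z) <=
   intg2 (- n%:R) n%:R (- n%:R) n%:R (fun z => phi n%:R z ^+ 2 * N z).
  apply: intg2_sub; try lra; first by cnt.
  by move=> w; rewrite mulr_ge0// sqr_ge0.
apply: lt_le_trans h1.
have h2 : 1 / 4 * J <= intg2 (- m%:R) m%:R (- m%:R) m%:R (fun z => phi n%:R z ^+ 2 * N z).
  rewrite /J -(intg2Z _ _ _ _ (1 / 4) cN); apply: intg2_le; [by cnt|by cnt|] => s t.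
  rewrite -!ler_norml => sm tm.
  apply: ler_wpM2r => //; apply: phi_lb => //; lra.
apply: lt_le_trans h2.
have -> : 2 * dl * M * (66 * K + 24) = 1 / 4 * (dl * B) by rewrite /B; field.
by rewrite ltr_pM2l// divr_gt0.
Qed.

Lemma energy_grad z : F1 z = 0 /\ F2 z = 0.
Proof.
have h1 := KF1 z; have h2 := KF2 z; rewrite energy_vanish !mulr0 in h1 h2.
by split; apply/eqP; rewrite -sqrf_eq0 eq_le ?h1 ?h2 sqr_ge0.
Qed.

(** The gradient of F vanishes with N, and a nonzero constant is not integrable
    over the plane. *)
Lemma energy_zero z : F z = 0.
Proof.
have Fc w : F w = F (0, 0).
  have [_ _ _ D1 D2] := HF; case: w => x y.
  transitivity (F (0, y)).
    apply: (@is_derive_0_is_cst _ (fun t => F (t, y))) => t.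
    by apply: is_derive_eq; have [] := energy_grad (t, y).
  apply: (@is_derive_0_is_cst _ (fun t => F (0, t))) => t.
  by apply: is_derive_eq; have [] := energy_grad (0, t).
rewrite Fc; apply/eqP; rewrite eq_le F0 andbT leNgt; apply/negP => F00.
have M0 : 0 <= M by apply: le_trans (intF 0); apply: intg2_ge0.
pose m := (Num.bound (M / F (0, 0))).+1.
have mb : M / F (0, 0) < m%:R.
  by apply: lt_trans (archi_boundP _) _; rewrite ?divr_ge0// ltr_nat.
have := intF m; rewrite (@eq_intg2 _ _ _ _ _ F (fun=> F (0, 0))); last by move=> ? ? _ _.
rewrite intg2_cst ?ge0_cp// leNgt => /negP; apply.
rewrite ltr_pdivrMr// in mb; apply: (lt_le_trans mb).
have m1 : (1 : R) <= m%:R by rewrite ler1n.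
have -> : (m%:R - - m%:R) * ((m%:R - - m%:R) * F (0, 0)) = 4 * m%:R * (m%:R * F (0, 0)) by ring.
rewrite ler_peMl ?mulr_ge0//; lra.
Qed.

End Energy.

(** * Liouville theorem for integrable solutions *)

Section Powers.
Context {R : realType}.
Implicit Types (P t th delta : R).

(** Concavity of the power th: its graph lies below the tangent at P, evaluated
    at 1. It is Young's inequality for the exponents 1 / th and 1 / (1 - th). *)
Lemma powR_tangent P th : 1 <= P -> 0 < th <= 1 ->
  th * (P - 1) * P `^ (th - 1) <= P `^ th - 1.
Proof.
move=> P1 /andP[th0 th1].
have P0 : 0 < P by exact: lt_le_trans P1.
have E : P * P `^ (th - 1) = P `^ th by rewrite mulr_powRB1// ltW.
move: th1; rewrite le_eqVlt => /predU1P[->|th1].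
  by rewrite subrr powRr0 (powRr1 (ltW P0)) mul1r mulr1.
have th1' : 0 < 1 - th by rewrite subr_gt0.
have := @conjugate_powR R (P^-1 `^ th) 1 th^-1 (1 - th)^-1.
rewrite powR_ge0 ler01 !invr_gt0 !invrK th0 th1' addrC subrK mulr1 powR1 mul1r.
move=> /(_ isT isT isT isT erefl).
rewrite -powRrM mulfV ?gt_eqF// powRr1 ?invr_ge0 ?(ltW P0)// => H.
have Pth : 0 < P `^ th by exact: powR_gt0.
have e1 : P `^ th * P^-1 `^ th = 1.
  by rewrite -powRM ?invr_ge0 ?(ltW P0)// mulfV ?gt_eqF// powR1.
have := ler_wpM2l (ltW Pth) H; rewrite e1.
have -> : P `^ th * (P^-1 * th + (1 - th)) = th * P `^ (th - 1) + (1 - th) * P `^ th.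
  by rewrite -E; field; rewrite gt_eqF.
rewrite -E; set B := P `^ (th - 1); move=> {}H; lra.
Qed.

(** Numbers of [0, 1] are at most their th-th power; apply this to 1 / (1 + t)
    and t / (1 + t), whose sum is 1. *)
Lemma powR_subadd t th : 0 <= t -> 0 < th <= 1 -> (1 + t) `^ th <= 1 + t `^ th.
Proof.
move=> t0 /andP[th0 th1].
have P0 : 0 < 1 + t by rewrite ltr_pwDl.
move: t0; rewrite le_eqVlt => /predU1P[<-|t0].
  by rewrite addr0 powR1 powR0 ?addr0// gt_eqF.
have h1 : (1 + t)^-1 <= (1 + t)^-1 `^ th.
  by apply: ger1_powR => //; rewrite invr_gt0 P0/= invf_le1// lerDl ltW.
have h2 : t / (1 + t) <= (t / (1 + t)) `^ th.
  by apply: ger1_powR => //; rewrite divr_gt0//= ler_pdivrMr// mul1r lerDr.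
have e : (1 + t)^-1 + t / (1 + t) = 1 by field; rewrite gt_eqF.
have Pth : 0 < (1 + t) `^ th by exact: powR_gt0.
have : 1 <= (1 + t)^-1 `^ th + (t / (1 + t)) `^ th by apply: le_trans (lerD h1 h2); rewrite e.
move=> /(ler_wpM2l (ltW Pth)); rewrite mulr1 mulrDr -!powRM ?divr_ge0 ?invr_ge0 ?(ltW t0) ?(ltW P0)//.
by rewrite mulfV ?gt_eqF// powR1 mulrCA mulfV ?gt_eqF// mulr1.
Qed.

(** Where t > delta, the power q0 - 1 of t / delta is at least 1. *)
Lemma le_delta_powR (q0 : R) delta t : 1 < q0 -> 0 < delta -> 0 <= t ->
  t <= delta + delta `^ (1 - q0) * t `^ q0.
Proof.
move=> q1 d0 t0; have [td|dt] := leP t delta.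
  by apply: (le_trans td); rewrite lerDl mulr_ge0// powR_ge0.
apply: (@le_trans _ _ (delta `^ (1 - q0) * t `^ q0)); last by rewrite lerDr ltW.
rewrite -(mulr_powRB1 t0 (lt_trans ltr01 q1)) mulrCA ler_peMr//.
rewrite -opprB powRN ler_pdivlMl ?powR_gt0// mulr1.
apply: ge0_ler_powR; rewrite ?nnegrE ?subr_ge0 ?(ltW q1)//; exact: ltW.
Qed.

End Powers.

Section Weight.
Context {R : realType} (q0 : R) (j : nat).
Hypotheses (q1 : 1 < q0) (qm : q0 <= (j.+1).*2%:R).

Let m : R := (j.+1).*2%:R.
Let th : R := q0 / m.
Let P (s : R) : R := 1 + s ^+ (j.+1).*2.

Let m0 : 0 < m. Proof. by rewrite ltr0n. Qed.
Let th01 : 0 < th <= 1.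
Proof. by rewrite divr_gt0 ?(lt_trans ltr01 q1)//= ler_pdivrMr// mul1r. Qed.
Let thm : th * m = q0. Proof. by rewrite /th divfK// gt_eqF. Qed.

Let t_ge0 (s : R) : 0 <= s ^+ (j.+1).*2.
Proof. by rewrite exprn_even_ge0// odd_double. Qed.

Let P_ge1 (s : R) : 1 <= P s. Proof. by rewrite lerDl. Qed.
Let P_gt0 (s : R) : 0 < P s. Proof. exact: lt_le_trans (P_ge1 s). Qed.

(** A C^2 convex substitute for |s|^q0 with an even exponent m = 2j + 2 >= q0:
    it behaves like s^m near 0 and like |s|^q0 at infinity, lies below |s|^q0, and
    vanishes only at 0. *)
Definition weight (s : R) := P s `^ th - 1.
Definition weight' (s : R) := th * P s `^ (th - 1) * (m * s ^+ (j.*2).+1).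
Definition weight'' (s : R) :=
  th * ((th - 1) * P s `^ (th - 2) * (m * s ^+ (j.*2).+1)) * (m * s ^+ (j.*2).+1)
  + th * P s `^ (th - 1) * (m * ((m - 1) * s ^+ j.*2)).

Let dX k (s : R) : is_derive s (1 : R) (fun s => s ^+ k) (k%:R * s ^+ k.-1).
Proof.
split; first exact: exprn_derivable.
by rewrite exp_derive /GRing.scale/= mulr1.
Qed.

Let dP (s : R) : is_derive s (1 : R) P (m * s ^+ (j.*2).+1).
Proof.
apply: (is_derive_eq (is_deriveD (is_derive_cst (1 : R) s (1 : R)) (dX (j.+1).*2 s))).
by rewrite add0r doubleS.
Qed.

Let dpowP a (s : R) : is_derive s (1 : R) (fun s => P s `^ a)
  (a * P s `^ (a - 1) * (m * s ^+ (j.*2).+1)).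
Proof. exact: (is_derive1_comp (is_derive1_powR a (P_gt0 s)) (dP s)). Qed.

Lemma dweight (s : R) : is_derive s (1 : R) weight (weight' s).
Proof.
by apply: (is_derive_eq (is_deriveB (dpowP th s) (is_derive_cst (1 : R) s (1 : R)))); rewrite subr0.
Qed.

Lemma dweight' (s : R) : is_derive s (1 : R) weight' (weight'' s).
Proof.
have H1 := is_deriveM (is_derive_cst th s (1 : R)) (dpowP (th - 1) s).
have H2 := is_deriveM (is_derive_cst m s (1 : R)) (dX (j.*2).+1 s).
apply: (is_derive_eq (is_deriveM H1 H2)).
rewrite /weight'' -addrA -opprD.
change (th * P s `^ (th - 1) * (m * ((j.*2).+1%:R * s ^+ j.*2) + s ^+ (j.*2).+1 * 0)
  + m * s ^+ (j.*2).+1 * (th * ((th - 1) * P s `^ (th - (1 + 1)) * (m * s ^+ (j.*2).+1)) + P s `^ (th - 1) * 0) =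
  th * ((th - 1) * P s `^ (th - 2) * (m * s ^+ (j.*2).+1)) * (m * s ^+ (j.*2).+1)
  + th * P s `^ (th - 1) * (m * ((m - 1) * s ^+ j.*2))).
have -> : (j.*2).+1%:R = m - 1 :> R by rewrite /m doubleS -[in RHS]natr1 addrK.
by ring.
Qed.

Lemma cnt_weight' : continuous weight'. Proof. exact: derive_continuous dweight'. Qed.
Lemma cnt_weight'' : continuous weight''.
Proof.
have c1 := derive_continuous (dpowP (th - 1)).
have c2 := derive_continuous (dpowP (th - 2)).
have c3 := derive_continuous (dX (j.*2).+1).
have c4 := derive_continuous (dX (j.*2)).
change (continuous (fun s : R => th * ((th - 1) * P s `^ (th - 2) * (m * s ^+ (j.*2).+1)) * (m * s ^+ (j.*2).+1)
  + th * P s `^ (th - 1) * (m * ((m - 1) * s ^+ j.*2)))).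
by cnt.
Qed.

Let powR_th1 (s : R) : P s `^ (th - 1) = P s * P s `^ (th - 2).
Proof.
have -> : th - 1 = (th - 2) + 1 by ring.
by rewrite powRD ?powRr1 ?(ltW (P_gt0 _)) ?(gt_eqF (P_gt0 _)) ?implybT// mulrC.
Qed.

Lemma weight_ge (s : R) : th * s ^+ (j.+1).*2 * P s `^ (th - 1) <= weight s.
Proof.
by have := powR_tangent (P_ge1 s) th01; rewrite /weight {1}/P [1 + _]addrC addrK.
Qed.

Lemma weight_ge0 (s : R) : 0 <= weight s.
Proof.
apply: le_trans (weight_ge s); have /andP[/ltW h _] := th01.
by rewrite mulr_ge0 ?powR_ge0// mulr_ge0.
Qed.

Lemma weight_le (s : R) : weight s <= `|s| `^ q0.
Proof.
rewrite /weight lerBlDl; apply: (le_trans (powR_subadd (t_ge0 s) th01)).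
rewrite lerD2l.
have -> : s ^+ (j.+1).*2 = `|s| `^ m.
  by rewrite powR_mulrn// -normrX ger0_norm.
by rewrite -powRrM mulrC thm.
Qed.

Lemma weight_eq0 (s : R) : weight s = 0 -> s = 0.
Proof.
move=> W0; have := weight_ge s; rewrite W0 => H.
have /andP[h _] := th01.
have : s ^+ (j.+1).*2 <= 0.
  by move: H; rewrite pmulr_lle0 ?powR_gt0// pmulr_rle0.
rewrite le_eqVlt ltNge t_ge0 orbF expf_eq0 => /andP[_ /eqP //].
Qed.

Let weight''E (s : R) : weight'' s = th * m * s ^+ j.*2 * P s `^ (th - 2) * ((m - 1) + (q0 - 1) * s ^+ (j.+1).*2).
Proof.
rewrite /weight'' powR_th1 -thm /P doubleS !exprS.
set V := (_ `^ _); set z := s ^+ j.*2; ring.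
Qed.

Let weight''_ge (s : R) : th * m * s ^+ j.*2 * P s `^ (th - 2) * ((q0 - 1) * P s) <= weight'' s.
Proof.
rewrite weight''E; apply: ler_wpM2l.
  have /andP[/ltW h _] := th01; apply: mulr_ge0; last exact: powR_ge0.
  apply: mulr_ge0; first by rewrite mulr_ge0// ltW.
  by rewrite exprn_even_ge0// odd_double.
by rewrite /P mulrDr mulr1 lerD2r lerD2r.
Qed.

Lemma weight''_ge0 (s : R) : 0 <= weight'' s.
Proof.
apply: le_trans (weight''_ge s); have /andP[/ltW h _] := th01.
apply: mulr_ge0; last by rewrite mulr_ge0 ?subr_ge0 ?(ltW q1)// ltW.
apply: mulr_ge0; last exact: powR_ge0.
apply: mulr_ge0; first by rewrite mulr_ge0// ltW.
by rewrite exprn_even_ge0// odd_double.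
Qed.

(** The differential inequality that makes [weight] admissible in the energy
    estimate. It combines the tangent inequality for [weight] with the lower
    bound of [weight''] by its main term; the constant blows up as q0 tends to 1,
    where the growth of [weight] at infinity becomes linear. *)
Lemma weight'_sqr (s : R) : weight' s ^+ 2 <= m / (q0 - 1) * (weight s * weight'' s).
Proof.
have /andP[/ltW h _] := th01.
have q10 : 0 < q0 - 1 by rewrite subr_gt0.
have h1 : 0 <= th * s ^+ (j.+1).*2 * P s `^ (th - 1).
  by rewrite mulr_ge0 ?powR_ge0// mulr_ge0.
have h2 : 0 <= th * m * s ^+ j.*2 * P s `^ (th - 2) * ((q0 - 1) * P s).
  apply: mulr_ge0; last by rewrite mulr_ge0 ?(ltW q10)// ltW.
  apply: mulr_ge0; last exact: powR_ge0.
  apply: mulr_ge0; first by rewrite mulr_ge0// ltW.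
  by rewrite exprn_even_ge0// odd_double.
have H := ler_pM h1 h2 (weight_ge s) (weight''_ge s).
have mq : 0 <= m / (q0 - 1) by rewrite divr_ge0 ?ltW.
apply: le_trans (ler_wpM2l mq H).
rewrite /weight' powR_th1 doubleS !exprS.
set V := (_ `^ _); set z := s ^+ j.*2.
rewrite le_eqVlt; apply/orP; left; apply/eqP; field.
by rewrite gt_eqF.
Qed.

End Weight.

Section Liouville.
Context {R : realType} (q0 M : R) (q1 : 1 < q0).
Variables (p p1 p2 q q_1 q_2 v v1 v2 v11 v12 v21 v22 : R * R -> R).
Hypotheses (Hp : C1 p p1 p2) (Hq : C1 q q_1 q_2) (divpq : forall z, p1 z + q_2 z = 0).
Hypotheses (Sp : slow p) (Sq : slow q).
Hypotheses (Hv : C1 v v1 v2) (Hv1 : C1 v1 v11 v12) (Hv2 : C1 v2 v21 v22).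
Hypothesis eqn : forall z, v11 z + v22 z = p z * v1 z + q z * v2 z.
Hypothesis cpow : continuous (fun z => `|v z| `^ q0).
Hypothesis intv : forall n : nat, intg2 (- n%:R) n%:R (- n%:R) n%:R (fun z => `|v z| `^ q0) <= M.

(** [weight] composed with v is a nonnegative subsolution, integrable because it
    lies below |v|^q0; [energy_zero] applies to it. *)
Lemma Liouville z : v z = 0.
Proof.
(* any j with q0 <= 2j + 2 would do *)
pose j := Num.bound q0.
have q0_ge0 : 0 <= q0 by rewrite ltW// (lt_trans ltr01).
have qm : q0 <= (j.+1).*2%:R.
  apply: (@le_trans _ _ (Num.bound q0)%:R); first by rewrite ltW// archi_boundP.
  by rewrite ler_nat -addnn leqW// leq_addr.
have HF := C1comp Hv (@cnt_weight' _ q0 j) (@dweight _ q0 j).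
have HW' := C1comp Hv (@cnt_weight'' _ q0 j) (@dweight' _ q0 j).
have HF1 := C1M HW' Hv1; have HF2 := C1M HW' Hv2.
have NE w : (weight'' q0 j (v w) * v1 w * v1 w + weight' q0 j (v w) * v11 w +
    (weight'' q0 j (v w) * v2 w * v2 w + weight' q0 j (v w) * v22 w) -
    (p w * (weight' q0 j (v w) * v1 w) + q w * (weight' q0 j (v w) * v2 w))) =
    weight'' q0 j (v w) * (v1 w ^+ 2 + v2 w ^+ 2).
  have e : v11 w = p w * v1 w + q w * v2 w - v22 w by rewrite -eqn addrK.
  by rewrite e; ring.
apply: (@weight_eq0 _ q0 j q1 qm).
have K0 : 0 <= (j.+1).*2%:R / (q0 - 1) by rewrite divr_ge0// subr_ge0 ltW.
have Ksq w (a b : R) : a ^+ 2 <= b -> (weight' q0 j (v w) * a) ^+ 2 <=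
    (j.+1).*2%:R / (q0 - 1) * (weight q0 j (v w) * (weight'' q0 j (v w) * b)).
  move=> ab; rewrite exprMn.
  apply: (le_trans (ler_pM (sqr_ge0 _) (sqr_ge0 _) (weight'_sqr q1 qm (v w)) ab)).
  by rewrite -!mulrA.
apply: (@energy_zero _ p p1 p2 q q_1 q_2 _ _ _ _ _ _ _ _ M Hp Hq divpq HF HF1 HF2 _ _ K0 _ _ _ Sp Sq z).
- by move=> w; exact: weight_ge0.
- by move=> w; rewrite NE mulr_ge0 ?weight''_ge0// addr_ge0// sqr_ge0.
- by move=> w; rewrite NE; apply: Ksq; rewrite lerDl sqr_ge0.
- by move=> w; rewrite NE; apply: Ksq; rewrite lerDr sqr_ge0.
- move=> n; apply: le_trans (intv n); apply: intg2_le => //; first by case: HF.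
  by move=> x y _ _; exact: weight_le.
Qed.

End Liouville.

(** * Divergence theorem on rectangles and stream functions *)

Section Stream.
Context {R : realType}.
Implicit Types (f g : R * R -> R) (a b c d x y s t : R).

Lemma lipschitz_of_derive (h h' : R -> R) (k : R) a b s t : continuous h' ->
  (forall t, is_derive t (1 : R) h (h' t)) -> a <= s <= b -> a <= t <= b ->
  (forall r, a <= r <= b -> `|h' r| <= k) -> `|h s - h t| <= k * `|s - t|.
Proof.
move=> ch dh hs ht hk.
have key u v : a <= u -> u <= v -> v <= b -> `|h v - h u| <= k * `|v - u|.
  move=> au uv vb; have ach : continuous (fun r => `|h' r|) by exact: cntA.
  rewrite -(intg_FTC uv ch dh); apply: (le_trans (intg_abs _ _ ch)).
  rewrite ger0_norm ?subr_ge0// mulrC; apply: intg_le_cst => // r /andP[ur rv].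
  by apply: hk; rewrite (le_trans au)//= (le_trans rv).
move: hs ht => /andP[as_ sb] /andP[at_ tb].
by case/orP: (le_total t s) => ts; [|rewrite distrC [`|s - t|]distrC]; exact: key.
Qed.

(** Continuous partial derivatives are locally bounded, hence f is locally
    Lipschitz and in particular jointly continuous. *)
Lemma C1_intro f f1 f2 : continuous f1 -> continuous f2 ->
  (forall x y, is_derive x (1 : R) (fun t => f (t, y)) (f1 (x, y))) ->
  (forall x y, is_derive y (1 : R) (fun t => f (x, t)) (f2 (x, y))) ->
  C1 f f1 f2.
Proof.
move=> c1 c2 D1 D2; split => //; case=> x0 y0.
have [M1 H1] := @cont_bounded_rect _ f1 (x0 - 1) (x0 + 1) (y0 - 1) (y0 + 1) c1.
have [M2 H2] := @cont_bounded_rect _ f2 (x0 - 1) (x0 + 1) (y0 - 1) (y0 + 1) c2.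
have x0in : x0 - 1 <= x0 <= x0 + 1 by apply/andP; split; lra.
have y0in : y0 - 1 <= y0 <= y0 + 1 by apply/andP; split; lra.
have M10 : 0 <= M1 by exact: le_trans (H1 _ _ x0in y0in).
have M20 : 0 <= M2 by exact: le_trans (H2 _ _ x0in y0in).
apply/cvgrPdist_le => e e0.
pose r := Num.min 1 (e / (M1 + M2 + 1)).
have MM : 0 < M1 + M2 + 1 by rewrite ltr_wpDl// addr_ge0.
have r0 : 0 < r by rewrite lt_min ltr01 divr_gt0.
have r1 : r <= 1 by rewrite ge_min lexx.
have re : (M1 + M2) * r <= e.
  apply: (@le_trans _ _ ((M1 + M2 + 1) * r)); first by rewrite ler_pM2r// lerDl.
  by rewrite mulrC -ler_pdivlMr// ge_min lexx orbT.
have : nbhs ((x0, y0) : R * R) (ball ((x0, y0) : R * R) r) by exact: nbhsx_ballx.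
apply: filterS => -[x y] [/= /ltW hx /ltW hy].
have xin : x0 - 1 <= x <= x0 + 1.
  by rewrite -ler_distlC; apply: le_trans r1.
have yin : y0 - 1 <= y <= y0 + 1.
  by rewrite -ler_distlC; apply: le_trans r1.
have e1 : `|f (x0, y0) - f (x, y0)| <= M1 * `|x0 - x|.
  apply: (@lipschitz_of_derive (fun t => f (t, y0)) (fun t => f1 (t, y0)) M1 (x0 - 1) (x0 + 1)) => //.
    exact: cnt_slice1.
  by move=> t ht; exact: H1.
have e2 : `|f (x, y0) - f (x, y)| <= M2 * `|y0 - y|.
  apply: (@lipschitz_of_derive (fun t => f (x, t)) (fun t => f2 (x, t)) M2 (y0 - 1) (y0 + 1)) => //.
    exact: cnt_slice2.
  by move=> t ht; exact: H2.
have -> : f (x0, y0) - f (x, y) = (f (x0, y0) - f (x, y0)) + (f (x, y0) - f (x, y)) by ring.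
apply: (le_trans (ler_normD _ _)); apply: le_trans re.
rewrite mulrDl; apply: lerD.
  by apply: (le_trans e1); rewrite ler_wpM2l.
by apply: (le_trans e2); rewrite ler_wpM2l.
Qed.

Lemma divergence_rect f f1 f2 g g1 g2 a b c d : C1 f f1 f2 -> C1 g g1 g2 ->
  a <= b -> c <= d ->
  intg2 a b c d (fun z => f1 z + g2 z) =
  intg c d (fun y => f (b, y) - f (a, y)) + intg a b (fun x => g (x, d) - g (x, c)).
Proof.
move=> Hf Hg ab cd; have [_ c1 _ _ _] := Hf; have [_ _ c2 _ _] := Hg.
by rewrite intg2D// (C1_FTC1 _ _ Hf ab) (C1_FTC2 _ _ Hg cd).
Qed.

Lemma divergence_bound f f1 f2 g g1 g2 a b c d B : C1 f f1 f2 -> C1 g g1 g2 ->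
  a <= b -> c <= d ->
  intg c d (fun y => `|f (b, y)|) <= B -> intg c d (fun y => `|f (a, y)|) <= B ->
  intg a b (fun x => `|g (x, d)|) <= B -> intg a b (fun x => `|g (x, c)|) <= B ->
  `|intg2 a b c d (fun z => f1 z + g2 z)| <= 4 * B.
Proof.
move=> Hf Hg ab cd h1 h2 h3 h4; rewrite (divergence_rect Hf Hg ab cd).
have [cf _ _ _ _] := Hf; have [cg _ _ _ _] := Hg.
have key (h k : R -> R) u v : continuous h -> continuous k ->
   intg u v (fun t => `|h t|) <= B -> intg u v (fun t => `|k t|) <= B ->
   `|intg u v (fun t => h t - k t)| <= 2 * B.
  move=> ch ck H1 H2; rewrite intg_B//; apply: (le_trans (ler_normB _ _)).
  have := le_trans (intg_abs u v ch) H1; have := le_trans (intg_abs u v ck) H2; lra.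
apply: (le_trans (ler_normD _ _)).
have -> : 4 * B = 2 * B + 2 * B by ring.
by apply: lerD; apply: key => //; try exact: cnt_slice2; exact: cnt_slice1.
Qed.

Section StreamFunction.
Variables (b1 b11 b12 b2 b21 b22 : R * R -> R).
Hypotheses (Hb1 : C1 b1 b11 b12) (Hb2 : C1 b2 b21 b22) (divb : forall z, b11 z + b22 z = 0).

Let cb1 : continuous b1. Proof. by case: Hb1. Qed.
Let cb2 : continuous b2. Proof. by case: Hb2. Qed.

(** Integral of the rotated field along the path from the origin to (x, 0) and
    then to (x, y). *)
Definition stream (z : R * R) : R :=
  prim (fun s => b1 (z.1, s)) z.2 - prim (fun s => b2 (s, 0)) z.1.

(** The divergence theorem on the rectangle with sides [x, x'] and the segment
    from 0 to y. *)
Lemma stream_row (x x' y : R) : x <= x' ->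
  stream (x', y) - stream (x, y) =
  prim (fun s => b2 (s, y)) x - prim (fun s => b2 (s, y)) x'.
Proof.
move=> xx'.
have [_ c11 _ _ _] := Hb1; have [_ _ c22 _ _] := Hb2.
pose A y := prim (fun s => b1 (x', s)) y - prim (fun s => b1 (x, s)) y.
pose B y := prim (fun s => b2 (s, y)) x' - prim (fun s => b2 (s, y)) x.
have rect c d : c <= d -> A d - A c = - (B d - B c).
  move=> cd; have := divergence_rect Hb1 Hb2 xx' cd.
  rewrite (@eq_intg2 _ _ _ _ _ _ (fun=> 0)); last by move=> ? ? _ _; exact: divb.
  rewrite intg2_cst// mulr0 mulr0.
  rewrite intg_B; [|exact: cnt_slice2|exact: cnt_slice2].
  rewrite intg_B; [|exact: cnt_slice1|exact: cnt_slice1].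
  rewrite !prim_split//; try exact: cnt_slice1; try exact: cnt_slice2.
  by rewrite /A /B => H; lra.
have : A y = - (B y - B 0).
  have A0 : A 0 = 0 by rewrite /A !prim0 subrr.
  case/orP: (le_total 0 y) => y0.
    by rewrite -(rect _ _ y0) A0 subr0.
  by have := rect _ _ y0; rewrite A0 sub0r => H; lra.
by rewrite /stream /A /B /=; lra.
Qed.

Lemma C1_stream : C1 stream (fun z => - b2 z) b1.
Proof.
apply: C1_intro => //; first exact: cntN.
  move=> x y.
  have -> : (fun t => stream (t, y)) = (fun t => stream (0, y) - prim (fun s => b2 (s, y)) t).
    apply/funext => t; case/orP: (le_total 0 t) => t0.
      by have := stream_row y t0; rewrite prim0 sub0r => H; lra.
    by have := stream_row y t0; rewrite prim0 subr0 => H; lra.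
  have H := @prim_derive _ (fun s => b2 (s, y)) x (@cnt_slice1 _ b2 y cb2).
  have := is_deriveB (is_derive_cst (stream (0, y)) x (1 : R)) H.
  by rewrite sub0r.
move=> x y.
have H := @prim_derive _ (fun s => b1 (x, s)) y (@cnt_slice2 _ b1 x cb1).
have := is_deriveB H (is_derive_cst (prim (fun s => b2 (s, 0)) x) y (1 : R)).
by rewrite subr0.
Qed.
End StreamFunction.

(** Otherwise the difference of h and its mean would be positive, with zero
    integral. *)
Lemma le_mean (h : R -> R) a b : a < b -> continuous h ->
  exists2 x, a <= x <= b & h x * (b - a) <= intg a b h.
Proof.
move=> ab ch; apply: contrapT => H.
pose A := intg a b h / (b - a).
have ba : 0 < b - a by rewrite subr_gt0.
have hA x : a <= x <= b -> 0 < h x - A.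
  move=> hx; rewrite subr_gt0 ltNge; apply/negP => hle; apply: H; exists x => //.
  by rewrite -ler_pdivlMr.
have : 0 < intg a b (fun x => h x - A).
  have mid : a < (a + b) / 2 < b by rewrite !midf_lt.
  apply: (intg_gt0 _ mid); first by apply: cntB => //; exact: cntC.
    by move=> x /hA/ltW.
  by apply: hA; have /andP[/ltW -> /ltW ->] := mid.
rewrite intg_B//; last exact: cntC.
by rewrite intg_cst ?(ltW ab)// /A mulrCA mulfV ?gt_eqF// mulr1 subrr ltxx.
Qed.

Lemma intg_abs_mul_le (f k : R -> R) a b (kap B : R) : continuous f -> continuous k ->
  0 <= kap -> (forall t, a <= t <= b -> `|k t| <= kap) -> intg a b (fun t => `|f t|) <= B ->
  intg a b (fun t => `|f t * k t|) <= kap * B.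
Proof.
move=> cf ck k0 hk hB; apply: le_trans (ler_wpM2l k0 hB).
have caf : continuous (fun t => `|f t|) by exact: cntA.
rewrite -(intg_Z a b kap caf); apply: intg_le.
- by apply: cntA; exact: cntM.
- by apply: cntM => //; exact: cntC.
- by move=> t ht; rewrite normrM mulrC ler_wpM2r//; exact: hk.
Qed.

End Stream.

(** * Vanishing of the magnetic field *)

Lemma energy_algebra {R : realType} (b1 b2 b12 b21 u1 u2 u11 u22 chi : R) :
  u2 * b1 - u1 * b2 - (b12 - b21) = 0 -> u11 + u22 = 0 ->
  b1 ^+ 2 + b2 ^+ 2 = (- b21 * chi + - b2 * - b2 + (b12 * chi + b1 * b1))
   - 2^-1 * (u11 * (chi * chi) + u1 * (- b2 * chi + chi * - b2)
      + (u22 * (chi * chi) + u2 * (b1 * chi + chi * b1))).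
Proof.
move=> h1 h2; have -> : b12 = u2 * b1 - u1 * b2 + b21 by lra.
have -> : u22 = - u11 by lra.
by field.
Qed.

Section Magnetic.
Context {R : realType}.
Variables (b1 b11 b12 b2 b21 b22 u1 u11 u12 u2 u21 u22 : R * R -> R) (M cst0 : R).
Hypotheses (Hb1 : C1 b1 b11 b12) (Hb2 : C1 b2 b21 b22) (divb : forall z, b11 z + b22 z = 0).
Hypotheses (Hu1 : C1 u1 u11 u12) (Hu2 : C1 u2 u21 u22) (divu : forall z, u11 z + u22 z = 0).
Hypothesis flux : forall z, (u2 z * b1 z - u1 z * b2 z) - (b12 z - b21 z) = cst0.

Let psi := stream b1 b2.
Let cb1 : continuous b1. Proof. by case: Hb1. Qed.
Let cb2 : continuous b2. Proof. by case: Hb2. Qed.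
Let cu1 : continuous u1. Proof. by case: Hu1. Qed.
Let cu2 : continuous u2. Proof. by case: Hu2. Qed.
Let cpsi : continuous psi. Proof. by case: (C1_stream Hb1 Hb2 divb). Qed.
Let cb12 : continuous b12. Proof. by case: Hb1. Qed.
Let cb21 : continuous b21. Proof. by case: Hb2. Qed.

Section Rectangle.
Variables (x1 x2 y1 y2 g U : R).
Hypotheses (xx : x1 <= x2) (yy : y1 <= y2).
Hypotheses
  (br1 : intg y1 y2 (fun y => `|b1 (x2, y)|) <= g) (br2 : intg y1 y2 (fun y => `|b2 (x2, y)|) <= g)
  (bl1 : intg y1 y2 (fun y => `|b1 (x1, y)|) <= g) (bl2 : intg y1 y2 (fun y => `|b2 (x1, y)|) <= g)
  (bt1 : intg x1 x2 (fun x => `|b1 (x, y2)|) <= g) (bt2 : intg x1 x2 (fun x => `|b2 (x, y2)|) <= g)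
  (bb1 : intg x1 x2 (fun x => `|b1 (x, y1)|) <= g) (bb2 : intg x1 x2 (fun x => `|b2 (x, y1)|) <= g)
  (ur : intg y1 y2 (fun y => `|u1 (x2, y)|) <= U) (ul : intg y1 y2 (fun y => `|u1 (x1, y)|) <= U)
  (ut : intg x1 x2 (fun x => `|u2 (x, y2)|) <= U) (ub : intg x1 x2 (fun x => `|u2 (x, y1)|) <= U).

Let g0 : 0 <= g. Proof. by apply: le_trans br1; apply: intg_ge0. Qed.

(** Normalised at a corner, so that along the sides of the rectangle chi is at
    most the integral of the field over two sides. *)
Definition chi z := psi z - psi (x2, y2).

Lemma C1chi : C1 chi (fun z => - b2 z) b1.
Proof.
apply: (C1_eq (C1B (C1_stream Hb1 Hb2 divb) (C1cst (psi (x2, y2))))) => z; by rewrite subr0.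
Qed.

Let osc2 x y y' : y1 <= y <= y2 -> y1 <= y' <= y2 ->
  intg y1 y2 (fun y => `|b1 (x, y)|) <= g -> `|chi (x, y) - chi (x, y')| <= g.
Proof.
move=> hy hy'; apply: le_trans; have [_ _ _ _ D] := C1chi.
by apply: (@osc_le _ (fun t => chi (x, t)) (fun t => b1 (x, t))) => //; exact: cnt_slice2.
Qed.

Let osc1 x x' y : x1 <= x <= x2 -> x1 <= x' <= x2 ->
  intg x1 x2 (fun x => `|b2 (x, y)|) <= g -> `|chi (x, y) - chi (x', y)| <= g.
Proof.
move=> hx hx'; apply: le_trans; have [_ _ _ D _] := C1chi.
have -> : intg x1 x2 (fun x => `|b2 (x, y)|) = intg x1 x2 (fun x => `|- b2 (x, y)|).
  by apply: eq_intg => t _; rewrite normrN.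
apply: (@osc_le _ (fun t => chi (t, y)) (fun t => - b2 (t, y))) => //.
by apply: cntN; exact: cnt_slice1.
Qed.

Let chi0 : chi (x2, y2) = 0. Proof. by rewrite /chi subrr. Qed.
Let x1in : x1 <= x1 <= x2. Proof. by rewrite lexx. Qed.
Let x2in : x1 <= x2 <= x2. Proof. by rewrite lexx andbT. Qed.
Let y1in : y1 <= y1 <= y2. Proof. by rewrite lexx. Qed.
Let y2in : y1 <= y2 <= y2. Proof. by rewrite lexx andbT. Qed.

Let tri (r s t : R) : `|r - s| <= g -> `|s - t| <= g -> `|r - t| <= 2 * g.
Proof.
move=> h1 h2; have -> : r - t = (r - s) + (s - t) by ring.
apply: (le_trans (ler_normD _ _)); lra.
Qed.

Let chir y : y1 <= y <= y2 -> `|chi (x2, y)| <= 2 * g.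
Proof. by move=> hy; have := osc2 hy y2in br1; rewrite chi0 subr0 => h; have := g0; lra. Qed.
Let chit x : x1 <= x <= x2 -> `|chi (x, y2)| <= 2 * g.
Proof. by move=> hx; have := osc1 hx x2in bt2; rewrite chi0 subr0 => h; have := g0; lra. Qed.
Let chil y : y1 <= y <= y2 -> `|chi (x1, y)| <= 2 * g.
Proof.
by move=> hy; have := tri (osc2 hy y2in bl1) (osc1 x1in x2in bt2); rewrite chi0 subr0.
Qed.
Let chib x : x1 <= x <= x2 -> `|chi (x, y1)| <= 2 * g.
Proof.
by move=> hx; have := tri (osc1 hx x2in bb2) (osc2 y1in y2in br1); rewrite chi0 subr0.
Qed.
Let g20 : 0 <= 2 * g. Proof. by rewrite mulr_ge0. Qed.

Let cchi : continuous chi. Proof. by case: C1chi. Qed.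

(** The flux u2 b1 - u1 b2 is the divergence of chi (u1, u2) and the current is
    the divergence of (- b2, b1). Both integrals over the rectangle reduce to its
    sides, where the field is small and chi too. *)
Lemma rect_flux : `|cst0| * ((x2 - x1) * (y2 - y1)) <= 4 * g + 8 * (g * U).
Proof.
have H1 := divergence_bound (C1N Hb2) Hb1 xx yy.
have H2 := divergence_bound (C1M Hu1 C1chi) (C1M Hu2 C1chi) xx yy.
have {}H1 := H1 g.
have {}H2 := H2 (2 * g * U).
have e : cst0 * ((x2 - x1) * (y2 - y1)) =
  intg2 x1 x2 y1 y2 (fun z => u11 z * chi z + u1 z * - b2 z + (u22 z * chi z + u2 z * b1 z)) -
  intg2 x1 x2 y1 y2 (fun z => - b21 z + b12 z).
  have [_ cu11 _ _ _] := Hu1; have [_ _ cu22 _ _] := Hu2.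
  rewrite -intg2B; [|by cnt|by cnt].
  rewrite (@eq_intg2 _ _ _ _ _ _ (fun=> cst0)).
    by rewrite intg2_cst//; ring.
  move=> x y _ _; rewrite -(flux (x, y)).
  have -> : u22 (x, y) = - u11 (x, y) by apply/eqP; rewrite -addr_eq0 addrC divu.
  ring.
have a0 : 0 <= (x2 - x1) * (y2 - y1) by rewrite mulr_ge0// subr_ge0.
rewrite -[X in _ * X](ger0_norm a0) -normrM e; apply: (le_trans (ler_normB _ _)).
rewrite addrC; apply: lerD.
  apply: H1 => //.
  - rewrite (_ : intg _ _ _ = intg y1 y2 (fun y => `|b2 (x2, y)|))//.
    by apply: eq_intg => t _; rewrite normrN.
  - rewrite (_ : intg _ _ _ = intg y1 y2 (fun y => `|b2 (x1, y)|))//.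
    by apply: eq_intg => t _; rewrite normrN.
have -> : 8 * (g * U) = 4 * (2 * g * U) by ring.
apply: H2.
- by apply: intg_abs_mul_le => //; exact: cnt_slice2.
- by apply: intg_abs_mul_le => //; exact: cnt_slice2.
- by apply: intg_abs_mul_le => //; exact: cnt_slice1.
- by apply: intg_abs_mul_le => //; exact: cnt_slice1.
Qed.

(** The field chi (- b2, b1) has divergence |b|^2 + chi (b12 - b21), and when the
    constant is 0 the last term is the divergence of chi^2 (u1, u2) / 2. Hence the
    magnetic energy is a boundary term, quadratic in the size g of the field. *)
Lemma rect_energy : cst0 = 0 ->
  intg2 x1 x2 y1 y2 (fun z => b1 z ^+ 2 + b2 z ^+ 2) <= 8 * g ^+ 2 + 8 * (g ^+ 2 * U).
Proof.
move=> c0.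
have Hc2 := C1M C1chi C1chi.
have H1 := divergence_bound (C1M (C1N Hb2) C1chi) (C1M Hb1 C1chi) xx yy.
have H2 := divergence_bound (C1M Hu1 Hc2) (C1M Hu2 Hc2) xx yy.
have {}H1 := H1 (2 * g * g).
have {}H2 := H2 (2 * g * (2 * g) * U).
have [_ cu11 _ _ _] := Hu1; have [_ _ cu22 _ _] := Hu2.
set J1 := intg2 _ _ _ _ _ in H1; set J2 := intg2 _ _ _ _ _ in H2.
have -> : intg2 x1 x2 y1 y2 (fun z => b1 z ^+ 2 + b2 z ^+ 2) = J1 - 2^-1 * J2.
  rewrite /J1 /J2 -intg2Z; last by cnt.
  rewrite -intg2B; [|by cnt|by cnt].
  apply: eq_intg2 => x y _ _.
  by apply: energy_algebra; [rewrite flux | exact: divu].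
have {}H1 : `|J1| <= 4 * (2 * g * g).
  apply: H1.
  - apply: intg_abs_mul_le => //; try exact: cnt_slice2.
      by apply: cntN; exact: cnt_slice2.
    rewrite (_ : intg _ _ _ = intg y1 y2 (fun y => `|b2 (x2, y)|))//.
    by apply: eq_intg => t _; rewrite normrN.
  - apply: intg_abs_mul_le => //; try exact: cnt_slice2.
      by apply: cntN; exact: cnt_slice2.
    rewrite (_ : intg _ _ _ = intg y1 y2 (fun y => `|b2 (x1, y)|))//.
    by apply: eq_intg => t _; rewrite normrN.
  - by apply: intg_abs_mul_le => //; exact: cnt_slice1.
  - by apply: intg_abs_mul_le => //; exact: cnt_slice1.
have sq t : `|t| <= 2 * g -> `|t * t| <= 2 * g * (2 * g) by move=> ht; rewrite normrM ler_pM.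
have cc2 : continuous (fun z => chi z * chi z) by cnt.
have gg0 : 0 <= 2 * g * (2 * g) by rewrite mulr_ge0.
have {}H2 : `|J2| <= 4 * (2 * g * (2 * g) * U).
  apply: H2.
  - apply: (@intg_abs_mul_le _ (fun y => u1 (x2, y)) (fun y => chi (x2, y) * chi (x2, y))) => //.
    + exact: cnt_slice2.
    + exact: (@cnt_slice2 _ (fun z => chi z * chi z)).
    + by move=> t /chir/sq.
  - apply: (@intg_abs_mul_le _ (fun y => u1 (x1, y)) (fun y => chi (x1, y) * chi (x1, y))) => //.
    + exact: cnt_slice2.
    + exact: (@cnt_slice2 _ (fun z => chi z * chi z)).
    + by move=> t /chil/sq.
  - apply: (@intg_abs_mul_le _ (fun x => u2 (x, y2)) (fun x => chi (x, y2) * chi (x, y2))) => //.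
    + exact: cnt_slice1.
    + exact: (@cnt_slice1 _ (fun z => chi z * chi z)).
    + by move=> t /chit/sq.
  - apply: (@intg_abs_mul_le _ (fun x => u2 (x, y1)) (fun x => chi (x, y1) * chi (x, y1))) => //.
    + exact: cnt_slice1.
    + exact: (@cnt_slice1 _ (fun z => chi z * chi z)).
    + by move=> t /chib/sq.
have h1 := le_trans (ler_norm _) H1.
have h2 : - J2 <= 4 * (2 * g * (2 * g) * U) by apply: le_trans H2; rewrite -normrN ler_norm.
clear H1 H2.
have -> : 8 * g ^+ 2 = 4 * (2 * g * g) by ring.
have -> : 8 * (g ^+ 2 * U) = 2^-1 * (4 * (2 * g * (2 * g) * U)) by field.
lra.
Qed.

End Rectangle.

Hypothesis intb : forall a b c d, a <= b -> c <= d ->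
  intg2 a b c d (fun z => `|b1 z| + `|b2 z|) <= M.
Hypotheses (Su1 : slow u1) (Su2 : slow (fun z => u2 (swap z))).

Let beta z := `|b1 z| + `|b2 z|.
Let cbeta : continuous beta.
Proof. by change (continuous (fun z => `|b1 z| + `|b2 z|)); cnt. Qed.

Let good_x (k : R) (n : nat) : (0 < n)%N ->
  exists2 x, k <= x <= k + n%:R &
    intg (- (n + n)%:R) (n + n)%:R (fun y => beta (x, y)) <= M / n%:R.
Proof.
move=> n0; have n0' : 0 < n%:R :> R by rewrite ltr0n.
have kk : k < k + n%:R by rewrite ltrDl.
have [x hx H] := le_mean kk (@cnt_intg _ beta (- (n + n)%:R) (n + n)%:R cbeta).
exists x => //; rewrite ler_pdivlMr//; move: H; rewrite addrAC subrr add0r => /le_trans; apply.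
by apply: intb; [exact: ltW|rewrite ge0_cp].
Qed.

Let good_y (k : R) (n : nat) : (0 < n)%N ->
  exists2 y, k <= y <= k + n%:R &
    intg (- (n + n)%:R) (n + n)%:R (fun x => beta (x, y)) <= M / n%:R.
Proof.
move=> n0; have n0' : 0 < n%:R :> R by rewrite ltr0n.
have kk : k < k + n%:R by rewrite ltrDl.
have [x hx H] := le_mean kk (@cnt_intg' _ beta (- (n + n)%:R) (n + n)%:R cbeta).
exists x => //; rewrite ler_pdivlMr//; move: H; rewrite addrAC subrr add0r => /le_trans; apply.
rewrite -[leLHS]/(intg2 k (k + n%:R) (- (n + n)%:R) (n + n)%:R (fun z => beta (swap z))).
rewrite -intg2_swap//; apply: intb; [by rewrite ge0_cp|exact: ltW].
Qed.

Let M0 : 0 <= M.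
Proof. by apply: le_trans (intb (lexx 0) (lexx 0)); apply: intg2_ge0 => *; rewrite addr_ge0. Qed.

(** Each side is chosen in a window of length n so that the integral of the field
    along it is at most the mean over the window: g = M / n. As the velocity contributes at most 4 delta n^2 per
    side, the boundary terms of [rect_flux] are O(n) against an area of order n^2,
    and those of [rect_energy] are O(1 / n^2 + delta). *)
Lemma good_rect (delta : R) : 0 < delta -> delta <= 1 ->
  exists N : nat, forall n : nat, (N <= n)%N -> (0 < n)%N ->
  `|cst0| * n%:R <= 36 * M /\
  (cst0 = 0 -> intg2 (- n%:R) n%:R (- n%:R) n%:R (fun z => b1 z ^+ 2 + b2 z ^+ 2) <=
   8 * (M / n%:R) ^+ 2 + 32 * delta * M ^+ 2).
Proof.
move=> dl0 dl1.
have [N1 H1] := slow_segment cu1 Su1 dl0.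
have [N2 H2] := slow_segment (cnt_swap cu2) Su2 dl0.
exists (maxn N1 N2) => n; rewrite geq_max => /andP[n1 n2] n0.
have n0' : 0 < n%:R :> R by rewrite ltr0n.
have n1' : 1 <= n%:R :> R by rewrite ler1n.
have e2n : (n + n)%:R = n%:R + n%:R :> R by rewrite natrD.
have {}H1 := H1 (n + n)%N (leq_trans n1 (leq_addr _ _)).
have {}H2 := H2 (n + n)%N (leq_trans n2 (leq_addr _ _)).
have [x2 /andP[x2a x2b] Hx2] := good_x n%:R n0.
have [y2 /andP[y2a y2b] Hy2] := good_y n%:R n0.
have [x1 /andP[x1a x1b] Hx1] := good_x (- (n + n)%:R) n0.
have [y1 /andP[y1a y1b] Hy1] := good_y (- (n + n)%:R) n0.
rewrite -e2n in x2b y2b.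
have {}x1b : x1 <= - n%:R by rewrite e2n in x1b; lra.
have {}y1b : y1 <= - n%:R by rewrite e2n in y1b; lra.
have nn : - n%:R <= n%:R :> R by rewrite ge0_cp.
have xx : x1 <= x2 by exact: le_trans x1b (le_trans nn x2a).
have yy : y1 <= y2 by exact: le_trans y1b (le_trans nn y2a).
have x1n : `|x1| <= (n + n)%:R.
  by rewrite ler_norml x1a (le_trans xx x2b).
have x2n : `|x2| <= (n + n)%:R.
  by rewrite ler_norml x2b andbT (le_trans x1a xx).
have y1n : `|y1| <= (n + n)%:R.
  by rewrite ler_norml y1a (le_trans yy y2b).
have y2n : `|y2| <= (n + n)%:R.
  by rewrite ler_norml y2b andbT (le_trans y1a yy).
pose U := delta * (4 * n%:R ^+ 2).
have eU : delta * (n + n)%:R ^+ 2 = U by rewrite e2n /U; ring.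
have sub (h k : R -> R) a b B : continuous h -> continuous k -> (forall t, 0 <= h t) ->
   (forall t, h t <= k t) -> - (n + n)%:R <= a -> a <= b -> b <= (n + n)%:R ->
   intg (- (n + n)%:R) (n + n)%:R k <= B -> intg a b h <= B.
  move=> ch ck h0 hk ha hab hb; apply: le_trans.
  apply: (@le_trans _ _ (intg (- (n + n)%:R) (n + n)%:R h)); first exact: intg_sub.
  exact: intg_le.
have sx (f : R * R -> R) (x a b B : R) : continuous f -> (forall z, `|f z| <= beta z) ->
   - (n + n)%:R <= a -> a <= b -> b <= (n + n)%:R ->
   intg (- (n + n)%:R) (n + n)%:R (fun y => beta (x, y)) <= B -> intg a b (fun y => `|f (x, y)|) <= B.
  move=> cf hf; apply: (sub (fun y => `|f (x, y)|) (fun y => beta (x, y))) => //.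
    by apply: cntA; exact: cnt_slice2.
  exact: cnt_slice2.
have sy (f : R * R -> R) (y a b B : R) : continuous f -> (forall z, `|f z| <= beta z) ->
   - (n + n)%:R <= a -> a <= b -> b <= (n + n)%:R ->
   intg (- (n + n)%:R) (n + n)%:R (fun x => beta (x, y)) <= B -> intg a b (fun x => `|f (x, y)|) <= B.
  move=> cf hf; apply: (sub (fun x => `|f (x, y)|) (fun x => beta (x, y))) => //.
    by apply: cntA; exact: cnt_slice1.
  exact: cnt_slice1.
have l1 z : `|b1 z| <= beta z by rewrite lerDl.
have l2 z : `|b2 z| <= beta z by rewrite lerDr.
have ux x : `|x| <= (n + n)%:R -> intg y1 y2 (fun y => `|u1 (x, y)|) <= U.
  move=> hx; rewrite -eU.
  by apply: (sub _ (fun y => `|u1 (x, y)|) _ _ _ _ _ _ _ _ _ _ (H1 x hx)) => //;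
    apply: cntA; exact: cnt_slice2.
have uy y : `|y| <= (n + n)%:R -> intg x1 x2 (fun x => `|u2 (x, y)|) <= U.
  move=> hy; rewrite -eU.
  by apply: (sub _ (fun x => `|u2 (x, y)|) _ _ _ _ _ _ _ _ _ _ (H2 y hy)) => //;
    apply: cntA; exact: cnt_slice1.
have A1 := @rect_flux x1 x2 y1 y2 (M / n%:R) U xx yy.
have A2 := @rect_energy x1 x2 y1 y2 (M / n%:R) U xx yy.
have {}A1 : `|cst0| * ((x2 - x1) * (y2 - y1)) <= 4 * (M / n%:R) + 8 * (M / n%:R * U).
  by apply: A1;
  [exact: sx|exact: sx|exact: sx|exact: sx|exact: sy|exact: sy|exact: sy|exact: sy
  |exact: ux|exact: ux|exact: uy|exact: uy].
have {}A2 : cst0 = 0 -> intg2 x1 x2 y1 y2 (fun z => b1 z ^+ 2 + b2 z ^+ 2) <=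
   8 * (M / n%:R) ^+ 2 + 8 * ((M / n%:R) ^+ 2 * U).
  by apply: A2;
  [exact: sx|exact: sx|exact: sx|exact: sx|exact: sy|exact: sy|exact: sy|exact: sy
  |exact: ux|exact: ux|exact: uy|exact: uy].
split.
  have h : 4 * n%:R ^+ 2 <= (x2 - x1) * (y2 - y1).
    have -> : 4 * n%:R ^+ 2 = (2 * n%:R) * (2 * n%:R) :> R by ring.
    have e : 0 <= 2 * n%:R :> R by rewrite mulr_ge0.
    by apply: ler_pM => //; lra.
  have {}A1 := le_trans (ler_wpM2l (normr_ge0 cst0) h) A1.
  have h1 : M / n%:R <= M * n%:R.
    rewrite ler_pdivrMr// -mulrA ler_peMr//.
    by rewrite -[leLHS]mulr1 ler_pM.
  have h2 : M / n%:R * U <= 4 * (M * n%:R).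
    have -> : M / n%:R * U = delta * (4 * (M * n%:R)) by rewrite /U; field; rewrite gt_eqF.
    by rewrite ler_piMl// !mulr_ge0.
  rewrite -(ler_pM2r n0').
  have -> : `|cst0| * n%:R * n%:R = 4^-1 * (`|cst0| * (4 * n%:R ^+ 2)) by field.
  have h3 : 0 <= M * n%:R by rewrite mulr_ge0.
  lra.
move=> c0; apply: (@le_trans _ _ (intg2 x1 x2 y1 y2 (fun z => b1 z ^+ 2 + b2 z ^+ 2))).
  by apply: intg2_sub => //; [by cnt|move=> z; rewrite addr_ge0// sqr_ge0].
apply: (le_trans (A2 c0)); rewrite lerD2l /U.
rewrite le_eqVlt; apply/orP; left; apply/eqP; field.
by rewrite gt_eqF.
Qed.

Lemma flux_zero : cst0 = 0.
Proof.
apply/eqP; rewrite -normr_eq0 eq_le normr_ge0 andbT leNgt; apply/negP => c0.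
have [N H] := good_rect ltr01 (lexx 1).
pose n := (maxn N (Num.bound (36 * M / `|cst0|))).+1.
have [|//|h _] := H n; first by rewrite leqW// leq_maxl.
move: h; rewrite leNgt => /negP; apply.
rewrite [ltRHS]mulrC -ltr_pdivrMr//; have hb : 0 <= 36 * M / `|cst0| by rewrite divr_ge0// mulr_ge0.
by apply: (lt_le_trans (archi_boundP hb)); rewrite ler_nat leqW// leq_maxr.
Qed.

Lemma magnetic_zero z : b1 z = 0 /\ b2 z = 0.
Proof.
suff: b1 z ^+ 2 + b2 z ^+ 2 = 0.
  move/eqP; rewrite paddr_eq0 ?sqr_ge0// !sqrf_eq0 => /andP[/eqP -> /eqP ->] //.
apply/eqP; rewrite eq_le addr_ge0 ?sqr_ge0// andbT leNgt; apply/negP; case: z => x y Nz.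
pose S (z : R * R) := b1 z ^+ 2 + b2 z ^+ 2.
have cS : continuous S by change (continuous (fun z => b1 z ^+ 2 + b2 z ^+ 2)); cnt.
have S0 w : 0 <= S w by rewrite addr_ge0// sqr_ge0.
pose m := Num.bound (Num.max `|x| `|y|).
have : Num.max `|x| `|y| < m%:R by rewrite archi_boundP// le_max normr_ge0.
rewrite gt_max => /andP[]; rewrite !ltr_norml => xm ym.
have J0 : 0 < intg2 (- m%:R) m%:R (- m%:R) m%:R S by apply: (intg2_gt0 cS xm ym S0).
set J := intg2 _ _ _ _ _ in J0.
(* 40 = 8 + 32: the energy bound of [good_rect] once 1 / n <= delta <= 1 *)
pose B := 40 * M ^+ 2.
have B0 : 0 <= B by rewrite mulr_ge0// sqr_ge0.
have B1 : 0 < B + 1 by rewrite ltr_wpDl.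
pose dl := Num.min 1 (J / (B + 1)).
have dl0 : 0 < dl by rewrite lt_min ltr01 divr_gt0.
have dl1 : dl <= 1 by rewrite ge_min lexx.
have dlB : dl * B < J.
  apply: (@lt_le_trans _ _ (dl * (B + 1))); first by rewrite ltr_pM2l// ltrDl.
  by rewrite -ler_pdivlMr// ge_min lexx orbT.
have [N H] := good_rect dl0 dl1.
pose n := (maxn (maxn N m) (Num.bound dl^-1)).+1.
have nb : n%:R^-1 <= dl.
  rewrite invf_ple ?posrE ?ltr0n//.
  apply: (@le_trans _ _ (Num.bound dl^-1)%:R); last by rewrite ler_nat leqW// leq_maxr.
  by rewrite ltW// archi_boundP// invr_ge0 ltW.
have n_0 : 0 <= n%:R^-1 :> R by rewrite invr_ge0 ler0n.
have [|//|_ h] := H n; first by rewrite leqW// !leq_max leqnn.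
have {}h := h flux_zero.
have mn : m%:R <= n%:R :> R by rewrite ler_nat leqW// !leq_max leqnn orbT.
have : J <= dl * B.
  apply: (@le_trans _ _ (intg2 (- n%:R) n%:R (- n%:R) n%:R S)).
    have m0 : 0 <= m%:R :> R by [].
    by apply: intg2_sub => //; rewrite ?lerN2//; rewrite ge0_cp.
  apply: (le_trans h); rewrite exprMn.
  have k : n%:R^-1 ^+ 2 <= dl.
    by rewrite expr2; apply: (le_trans _ nb); apply: ler_piMl => //; exact: le_trans nb dl1.
  have := ler_wpM2l (sqr_ge0 M) k; rewrite /B => k'.
  have -> : dl * (40 * M ^+ 2) = 8 * (M ^+ 2 * dl) + 32 * dl * M ^+ 2 by ring.
  by rewrite lerD2r ler_wpM2l.
by rewrite leNgt dlB.
Qed.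

End Magnetic.

(** * Consequences of the integrability hypotheses *)

Section C1more.
Context {R : realType}.
Implicit Types (f g : R * R -> R).

Lemma C1_unique f f1 f2 g1 g2 : C1 f f1 f2 -> C1 f g1 g2 -> f1 =1 g1 /\ f2 =1 g2.
Proof.
move=> [_ _ _ D1 D2] [_ _ _ E1 E2]; split=> -[x y].
  by have [_ <-] := D1 x y; have [_ <-] := E1 x y.
by have [_ <-] := D2 x y; have [_ <-] := E2 x y.
Qed.

Lemma C1_const f f1 f2 : C1 f f1 f2 -> (forall z, f1 z = 0) -> (forall z, f2 z = 0) ->
  forall z, f z = f (0, 0).
Proof.
move=> [_ _ _ D1 D2] h1 h2 [x y]; transitivity (f (0, y)).
  apply: (@is_derive_0_is_cst _ (fun t => f (t, y))) => t.
  by apply: (is_derive_eq (D1 t y)); exact: h1.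
apply: (@is_derive_0_is_cst _ (fun t => f (0, t))) => t.
by apply: (is_derive_eq (D2 0 t)); exact: h2.
Qed.

Lemma partial_comm f : smooth f -> partial1 (partial2 f) = partial2 (partial1 f).
Proof.
move=> sf; apply/esym/funext.
exact: (Schwarz (smooth_C1 sf) (smooth_C1 (smooth_partial1 sf)) (smooth_C1 (smooth_partial2 sf))).
Qed.

(** At 0 the power is squeezed between 0 and |t|, as q0 > 1. *)
Lemma cnt_powR_norm (q0 : R) : 1 < q0 -> continuous (fun t : R => `|t| `^ q0).
Proof.
move=> q1 t; have [->|t0] := eqVneq t 0.
  apply/cvgrPdist_le => e e0.
  have q0' : q0 != 0 by rewrite gt_eqF// (lt_trans ltr01).
  rewrite normr0 powR0//.
  have r0 : 0 < Num.min 1 e by rewrite lt_min ltr01.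
  have : nbhs (0 : R) (ball (0 : R) (Num.min 1 e)) by exact: nbhsx_ballx.
  apply: filterS => s; rewrite /ball/= !sub0r !normrN lt_min => /andP[s1 se].
  rewrite ger0_norm ?powR_ge0//; apply: le_trans (ltW se).
  have [->|s0] := eqVneq s 0; first by rewrite normr0 powR0.
  by apply: ge1r_powR; [rewrite normr_gt0 s0 ltW | exact: ltW].
have ct : {for `|t|, continuous (fun s => s `^ q0)}.
  apply: differentiable_continuous; apply/derivable1_diffP.
  by apply: derivable_powR; rewrite in_itv/= andbT normr_gt0.
by apply: (@continuous_comp _ _ _ (fun t : R => `|t|) (fun s => s `^ q0)) => //; exact: norm_continuous.
Qed.

(** Transfers a norm on the plane into bounds uniform in the rectangle, the only
    form in which the norms are used. *)
Lemma intg2_le_integral f (M : R) : continuous f -> (forall z, 0 <= f z) ->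
  (\int[lebesgue2 R]_z (f z)%:E <= M%:E)%E -> forall a b c d, intg2 a b c d f <= M.
Proof.
move=> cf f0 H a b c d; rewrite -lee_fin intg2_lebesgue//; apply: le_trans H.
apply: ge0_subset_integral => //.
- by apply: measurableX; exact: measurable_itv.
- by apply/measurable_realfun.measurable_EFinP; exact: cnt_measurable.
- by move=> z _; rewrite lee_fin.
Qed.

Lemma Lpnorm_intg2 (q0 K : R) f : 1 < q0 -> continuous f -> Lpnorm q0%:E f = K%:E ->
  exists2 M : R, 0 <= M & forall a b c d, intg2 a b c d (fun z => `|f z| `^ q0) <= M.
Proof.
move=> q1 cf HK; exists (K `^ q0); first exact: powR_ge0.
apply: intg2_le_integral.
- exact: (cntO cf (cnt_powR_norm q1)).
- by move=> z; exact: powR_ge0.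
have q0' : q0 != 0 by rewrite gt_eqF// (lt_trans ltr01).
have := poweR_Lnorm (lebesgue2 R) (EFin \o f) q0'.
rewrite -[Lnorm _ _ _]/(Lpnorm q0%:E f) HK poweR_EFin => ->.
by rewrite le_eqVlt; apply/orP; left; apply/eqP; apply: eq_integral.
Qed.

Lemma L1norm_intg2 f (M : R) : continuous f -> (Lpnorm 1%E f <= M%:E)%E ->
  forall a b c d, intg2 a b c d (fun z => `|f z|) <= M.
Proof.
move=> cf H; apply: intg2_le_integral; [exact: cntA|by []|].
by move: H; rewrite /Lpnorm Lnorm1.
Qed.

Lemma intg2_powR_le (q0 M : R) f g : 1 < q0 -> continuous f -> continuous g ->
  (forall z, 0 <= g z) -> (forall z, `|f z| <= 2 * g z) ->
  (forall a b c d, intg2 a b c d (fun z => `|g z| `^ q0) <= M) ->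
  forall a b c d, intg2 a b c d (fun z => `|f z| `^ q0) <= 2 `^ q0 * M.
Proof.
move=> q1 cf cg g0 fg H a b c d.
have cgq : continuous (fun z => `|g z| `^ q0) by exact: (cntO cg (cnt_powR_norm q1)).
apply: (@le_trans _ _ (intg2 a b c d (fun z => 2 `^ q0 * `|g z| `^ q0))).
  apply: intg2_le.
  - exact: (cntO cf (cnt_powR_norm q1)).
  - by apply: cntM; [exact: cntC|exact: cgq].
  - move=> x y _ _; rewrite -powRM// (ger0_norm (g0 _)).
    by apply: ge0_ler_powR; rewrite ?nnegrE ?mulr_ge0// ltW// (lt_trans ltr01).
by rewrite intg2Z// ler_wpM2l// powR_ge0.
Qed.

Lemma sublinear_of_powR (q0 M : R) f : 1 < q0 -> continuous f ->
  (forall a b c d, intg2 a b c d (fun z => `|f z| `^ q0) <= M) -> sublinear f.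
Proof.
move=> q1 cf H dl dl0; exists (dl `^ (1 - q0) * M) => a b c d ab cd.
have cfq : continuous (fun z => `|f z| `^ q0) by exact: (cntO cf (cnt_powR_norm q1)).
have cC : continuous (fun z => dl `^ (1 - q0) * `|f z| `^ q0).
  by apply: cntM; [exact: cntC|exact: cfq].
apply: (@le_trans _ _ (intg2 a b c d (fun z => dl + dl `^ (1 - q0) * `|f z| `^ q0))).
  apply: intg2_le; [exact: cntA|by apply: cntD; [exact: cntC|exact: cC]|] => x y _ _.
  exact: le_delta_powR.
rewrite intg2D//; last exact: cntC.
rewrite intg2_cst// intg2Z//; apply: lerD; first by rewrite mulrA mulrC.
by rewrite ler_wpM2l// powR_ge0.
Qed.

Lemma slow_zero : slow (fun _ : R * R => (0 : R)).
Proof.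
move=> dl dl0; exists 0%N => n _ x c _ _ _; rewrite normr0 intg_cst ?lerDl//.
by rewrite mulr0 mulr_ge0// ltW.
Qed.
End C1more.

(** * Differential identities of the system *)

Section PureAlgebra.
Context {R : realType}.
(** [fij] stands for the derivative of the component [f_i] in direction [j];
   the trailing indices are the directions of further derivatives. *)
Lemma flux_algebra1 (U1 U2 B1 B2 u11 u12 u21 u22 b11 b12 b21 b22 b112 b211 b222 : R) :
  b112 + b222 = 0 -> b11 + b22 = 0 -> u11 + u22 = 0 ->
  - (b211 + b222) + (U1 * b21 + U2 * b22) = B1 * u21 + B2 * u22 ->
  u21 * B1 + U2 * b11 - (u11 * B2 + U1 * b21) - (b112 - b211) = 0.
Proof.
move=> h1 h2 h3 h4.
have -> : b112 = - b222 by lra.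
have -> : b11 = - b22 by lra.
have -> : u11 = - u22 by lra.
lra.
Qed.

Lemma flux_algebra2 (U1 U2 B1 B2 u11 u12 u21 u22 b11 b12 b21 b22 b122 b111 b212 : R) :
  b111 + b212 = 0 -> b11 + b22 = 0 -> u11 + u22 = 0 ->
  - (b111 + b122) + (U1 * b11 + U2 * b12) = B1 * u11 + B2 * u12 ->
  u22 * B1 + U2 * b12 - (u12 * B2 + U1 * b22) - (b122 - b212) = 0.
Proof.
move=> h1 h2 h3 h4.
have -> : b212 = - b111 by lra.
have -> : b22 = - b11 by lra.
have -> : u22 = - u11 by lra.
lra.
Qed.

Lemma vorticity_algebra (U1 U2 u11 u12 u21 u22 u112 u121 u122 u211 u212 u221 p12 p21
    u1112 u1121 u1222 u2111 u2122 u2221 : R) : u11 + u22 = 0 ->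
  p21 = p12 -> u112 = u121 -> u221 = u212 -> u1112 = u1121 -> u2221 = u2122 ->
  - (u1112 + u1222) + (u12 * u11 + U1 * u112 + (u22 * u12 + U2 * u122)) + p12 = 0 ->
  - (u2111 + u2221) + (u11 * u21 + U1 * u211 + (u21 * u22 + U2 * u221)) + p21 = 0 ->
  u1121 - u2111 + (u1222 - u2122) = U1 * (u121 - u211) + U2 * (u122 - u212).
Proof.
move=> h1 -> -> -> -> ->; have -> : u11 = - u22 by lra.
lra.
Qed.

Lemma drift0r (a b c x y : R) : a + b = 0 -> b = c -> a + c = 0 * x + 0 * y.
Proof. by move=> + <-; rewrite !mul0r addr0. Qed.

Lemma drift0l (a b c x y : R) : a + b = 0 -> a = c -> c + b = 0 * x + 0 * y.
Proof. by move=> + <-; rewrite !mul0r addr0. Qed.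

Lemma harmonic_algebra (u111 u212 u221 u122 : R) :
  u111 + u221 = 0 -> u221 = u212 -> u122 - u212 = 0 -> u111 + u122 = 0.
Proof. move=> h1 h2 h3; lra. Qed.

Lemma harmonic_algebra' (u112 u121 u211 u222 : R) :
  u112 + u222 = 0 -> u121 = u112 -> u121 - u211 = 0 -> u211 + u222 = 0.
Proof. move=> h1 h2 h3; lra. Qed.

Lemma pressure_algebra (l1 l2 U1 U2 v1 v2 p1 : R) :
  - (l1 + l2) + (U1 * v1 + U2 * v2) + p1 = 0 -> l1 + l2 = 0 -> v1 = 0 -> v2 = 0 -> p1 = 0.
Proof. by move=> h e1 e2 e3; move: h; rewrite e1 e2 e3 oppr0 !mulr0 !add0r. Qed.
End PureAlgebra.

Section Scalar.
Context {R : realType}.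
Implicit Types (f g : R * R -> R).

Lemma smooth_continuous f : smooth f -> continuous f.
Proof. by move=> /smooth_C1[]. Qed.

Lemma C1_zero f f1 f2 : C1 f f1 f2 -> (forall z, f z = 0) ->
  forall z, f1 z = 0 /\ f2 z = 0.
Proof.
move=> Hf f0; have fE : f = (fun=> 0) by apply/funext.
by rewrite fE in Hf; have [h1 h2] := C1_unique Hf (C1cst 0) => z; rewrite h1 h2.
Qed.

Lemma grad_component (a b c d : R) :
  [/\ `|a| <= Num.sqrt (a ^+ 2 + b ^+ 2 + c ^+ 2 + d ^+ 2),
      `|b| <= Num.sqrt (a ^+ 2 + b ^+ 2 + c ^+ 2 + d ^+ 2),
      `|c| <= Num.sqrt (a ^+ 2 + b ^+ 2 + c ^+ 2 + d ^+ 2)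
    & `|d| <= Num.sqrt (a ^+ 2 + b ^+ 2 + c ^+ 2 + d ^+ 2)].
Proof.
have := sqr_ge0 a; have := sqr_ge0 b; have := sqr_ge0 c; have := sqr_ge0 d => hd hc hb ha.
by split; rewrite -sqrtr_sqr ler_wsqrtr//; lra.
Qed.

Lemma enorm_component (a b : R) :
  `|a| + `|b| <= 2 * Num.sqrt (a ^+ 2 + b ^+ 2).
Proof.
have ha : `|a| <= Num.sqrt (a ^+ 2 + b ^+ 2).
  by rewrite -sqrtr_sqr ler_wsqrtr// lerDl sqr_ge0.
have hb : `|b| <= Num.sqrt (a ^+ 2 + b ^+ 2).
  by rewrite -sqrtr_sqr ler_wsqrtr// lerDr sqr_ge0.
lra.
Qed.

Lemma cnt_sqrt f : continuous f -> continuous (fun z => Num.sqrt (f z)).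
Proof. by move=> cf; exact: (cntO cf (@sqrt_continuous R)). Qed.

Variables u1 u2 : R * R -> R.
Hypotheses (su1 : smooth u1) (su2 : smooth u2).
Hypothesis du : forall z, partial1 u1 z + partial2 u2 z = 0.

(** The induction equation says that the rotated gradient of the difference of
    u2 b1 - u1 b2 and the current vanishes. *)
Lemma flux_const (b1 b2 : R * R -> R) : smooth b1 -> smooth b2 ->
  (forall z, partial1 b1 z + partial2 b2 z = 0) ->
  (forall z, - (partial1 (partial1 b1) z + partial2 (partial2 b1) z)
    + (u1 z * partial1 b1 z + u2 z * partial2 b1 z)
    = b1 z * partial1 u1 z + b2 z * partial2 u1 z) ->
  (forall z, - (partial1 (partial1 b2) z + partial2 (partial2 b2) z)
    + (u1 z * partial1 b2 z + u2 z * partial2 b2 z)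
    = b1 z * partial1 u2 z + b2 z * partial2 u2 z) ->
  exists c, forall z, (u2 z * b1 z - u1 z * b2 z) - (partial2 b1 z - partial1 b2 z) = c.
Proof.
move=> sb1 sb2 db ind1 ind2.
have HG := C1B (C1B (C1M (smooth_C1 su2) (smooth_C1 sb1)) (C1M (smooth_C1 su1) (smooth_C1 sb2)))
  (C1B (smooth_C1 (smooth_partial2 sb1)) (smooth_C1 (smooth_partial1 sb2))).
have Hdb := C1_zero (C1D (smooth_C1 (smooth_partial1 sb1)) (smooth_C1 (smooth_partial2 sb2))) db.
eexists; apply: (C1_const HG) => z; have [e1 e2] := Hdb z.
- rewrite (partial_comm sb1).
  exact: (flux_algebra1 (partial2 u1 z) (partial2 b1 z) e2 (db z) (du z) (ind2 z)).
- rewrite -(partial_comm sb2).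
  exact: (flux_algebra2 (partial1 u2 z) (partial1 b2 z) e1 (db z) (du z) (ind1 z)).
Qed.

(** The curl of the momentum equation; the stretching term is the vorticity times
    the divergence, which is zero. *)
Lemma vorticity_eq p : smooth p ->
  (forall z, - (partial1 (partial1 u1) z + partial2 (partial2 u1) z)
    + (u1 z * partial1 u1 z + u2 z * partial2 u1 z) + partial1 p z = 0) ->
  (forall z, - (partial1 (partial1 u2) z + partial2 (partial2 u2) z)
    + (u1 z * partial1 u2 z + u2 z * partial2 u2 z) + partial2 p z = 0) ->
  forall z,
  partial1 (partial1 (partial2 u1)) z - partial1 (partial1 (partial1 u2)) z
  + (partial2 (partial2 (partial2 u1)) z - partial2 (partial2 (partial1 u2)) z) =
  u1 z * (partial1 (partial2 u1) z - partial1 (partial1 u2) z)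
  + u2 z * (partial2 (partial2 u1) z - partial2 (partial1 u2) z).
Proof.
move=> sp mom1 mom2 z.
have S1 := smooth_partial1; have S2 := smooth_partial2; have SC := @smooth_C1 R.
have H1 := C1D (C1D (C1N (C1D (SC _ (S1 _ _ (S1 _ _ su1))) (SC _ (S2 _ _ (S2 _ _ su1)))))
  (C1D (C1M (SC _ su1) (SC _ (S1 _ _ su1))) (C1M (SC _ su2) (SC _ (S2 _ _ su1))))) (SC _ (S1 _ _ sp)).
have H2 := C1D (C1D (C1N (C1D (SC _ (S1 _ _ (S1 _ _ su2))) (SC _ (S2 _ _ (S2 _ _ su2)))))
  (C1D (C1M (SC _ su1) (SC _ (S1 _ _ su2))) (C1M (SC _ su2) (SC _ (S2 _ _ su2))))) (SC _ (S2 _ _ sp)).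
have [_ e1] := C1_zero H1 mom1 z.
have [e2 _] := C1_zero H2 mom2 z.
have at_z f g : f = g -> f z = g z by move=> ->.
have ep := at_z _ _ (partial_comm sp).
have eu2 := at_z _ _ (partial_comm su2).
have eu1 := at_z _ _ (esym (partial_comm su1)).
have eu111 := at_z _ _ (etrans (esym (partial_comm (S1 _ _ su1)))
  (congr1 partial1 (esym (partial_comm su1)))).
have eu222 := at_z _ _ (etrans (partial_comm (S2 _ _ su2)) (congr1 partial2 (partial_comm su2))).
exact: (vorticity_algebra (du z) ep eu1 eu2 eu111 eu222 e1 e2).
Qed.

End Scalar.

Section Harmonic.
Context {R : realType} (q0 M : R) (q1 : 1 < q0).
Implicit Types (f : R * R -> R).

(** The derivatives of f are harmonic, that is, solutions without drift. *)
Lemma harmonic_grad_zero f : smooth f ->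
  (forall z, partial1 (partial1 f) z + partial2 (partial2 f) z = 0) ->
  (forall a b c d, intg2 a b c d (fun z => `|partial1 f z| `^ q0) <= M) ->
  (forall a b c d, intg2 a b c d (fun z => `|partial2 f z| `^ q0) <= M) ->
  forall z, partial1 f z = 0 /\ partial2 f z = 0.
Proof.
move=> sf lap h1 h2 z.
have S1 := smooth_partial1; have S2 := smooth_partial2; have SC := @smooth_C1 R.
have Hlap := C1_zero (C1D (SC _ (S1 _ _ (S1 _ _ sf))) (SC _ (S2 _ _ (S2 _ _ sf)))) lap.
have c0 := C1cst (0 : R).
have cq g : smooth g -> continuous (fun z => `|g z| `^ q0).
  by move=> sg; exact: (cntO (smooth_continuous sg) (cnt_powR_norm q1)).
split.
- apply: (@Liouville _ q0 M q1 _ _ _ _ _ _ _ _ _ _ _ _ _ c0 c0 _ (@slow_zero R) (@slow_zero R)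
    (SC _ (S1 _ _ sf)) (SC _ (S1 _ _ (S1 _ _ sf))) (SC _ (S2 _ _ (S1 _ _ sf)))).
  + by move=> w; rewrite addr0.
  + move=> w; have [e _] := Hlap w; apply: (drift0r _ _ e).
    exact: (congr1 (fun g => g w)
      (etrans (partial_comm (S2 _ _ sf)) (congr1 partial2 (partial_comm sf)))).
  + exact/cq/S1.
  + by move=> n; exact: h1.
- apply: (@Liouville _ q0 M q1 _ _ _ _ _ _ _ _ _ _ _ _ _ c0 c0 _ (@slow_zero R) (@slow_zero R)
    (SC _ (S2 _ _ sf)) (SC _ (S1 _ _ (S2 _ _ sf))) (SC _ (S2 _ _ (S2 _ _ sf)))).
  + by move=> w; rewrite addr0.
  + move=> w; have [_ e] := Hlap w; apply: (drift0l _ _ e).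
    exact: (congr1 (fun g => g w)
      (etrans (esym (partial_comm (S1 _ _ sf))) (congr1 partial1 (esym (partial_comm sf))))).
  + exact/cq/S2.
  + by move=> n; exact: h2.
Qed.

End Harmonic.

(** * Rigidity of the magnetic field and of the flow *)

Section Main.
Context {R : realType} (q0 : R) (q1 : 1 < q0).
Variables (u1 u2 b1 b2 p : R * R -> R).
Hypotheses (su1 : smooth u1) (su2 : smooth u2) (sb1 : smooth b1) (sb2 : smooth b2) (sp : smooth p).
Hypotheses (du : forall z, partial1 u1 z + partial2 u2 z = 0)
           (db : forall z, partial1 b1 z + partial2 b2 z = 0).
Variables (M Mb : R).
Hypotheses
  (g11 : forall a b c d, intg2 a b c d (fun z => `|partial1 u1 z| `^ q0) <= M)
  (g12 : forall a b c d, intg2 a b c d (fun z => `|partial2 u1 z| `^ q0) <= M)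
  (g21 : forall a b c d, intg2 a b c d (fun z => `|partial1 u2 z| `^ q0) <= M)
  (g22 : forall a b c d, intg2 a b c d (fun z => `|partial2 u2 z| `^ q0) <= M).

Let slow_of_smooth f : smooth f ->
  (forall a b c d, intg2 a b c d (fun z => `|partial1 f z| `^ q0) <= M) ->
  (forall a b c d, intg2 a b c d (fun z => `|partial2 f z| `^ q0) <= M) ->
  slow f /\ slow (fun z => f (swap z)).
Proof.
move=> sf h1 h2.
have c1 := smooth_continuous (smooth_partial1 sf).
have c2 := smooth_continuous (smooth_partial2 sf).
have s1 := sublinear_of_powR q1 c1 h1; have s2 := sublinear_of_powR q1 c2 h2.
split; first exact: (slow_of_sublinear (smooth_C1 sf) s1 s2).
exact: (slow_of_sublinear (C1_swap (smooth_C1 sf)) (sublinear_swap c2 s2) (sublinear_swap c1 s1)).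
Qed.

Lemma magnetic_field_zero :
  (forall a b c d, intg2 a b c d (fun z => `|b1 z| + `|b2 z|) <= Mb) ->
  (forall z, - (partial1 (partial1 b1) z + partial2 (partial2 b1) z)
    + (u1 z * partial1 b1 z + u2 z * partial2 b1 z)
    = b1 z * partial1 u1 z + b2 z * partial2 u1 z) ->
  (forall z, - (partial1 (partial1 b2) z + partial2 (partial2 b2) z)
    + (u1 z * partial1 b2 z + u2 z * partial2 b2 z)
    = b1 z * partial1 u2 z + b2 z * partial2 u2 z) ->
  forall z, b1 z = 0 /\ b2 z = 0.
Proof.
move=> hb ind1 ind2.
have [c Hc] := flux_const su1 su2 du sb1 sb2 db ind1 ind2.
have [Su1 _] := slow_of_smooth su1 g11 g12.
have [_ Su2] := slow_of_smooth su2 g21 g22.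
apply: (magnetic_zero (smooth_C1 sb1) (smooth_C1 sb2) db (smooth_C1 su1) (smooth_C1 su2) du Hc _ Su1 Su2).
by move=> x1 x2 y1 y2 _ _; exact: hb.
Qed.

(** The vorticity vanishes by the Liouville theorem with drift (u1, u2). A
    divergence-free and curl-free field is harmonic, so its gradient vanishes by
    the Liouville theorem without drift, and then so does that of the pressure. *)
Lemma flow_constant (M' : R) :
  (forall a b c d, intg2 a b c d (fun z => `|partial2 u1 z - partial1 u2 z| `^ q0) <= M') ->
  (forall z, - (partial1 (partial1 u1) z + partial2 (partial2 u1) z)
    + (u1 z * partial1 u1 z + u2 z * partial2 u1 z) + partial1 p z = 0) ->
  (forall z, - (partial1 (partial1 u2) z + partial2 (partial2 u2) z)
    + (u1 z * partial1 u2 z + u2 z * partial2 u2 z) + partial2 p z = 0) ->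
  [/\ forall z, u1 z = u1 (0, 0), forall z, u2 z = u2 (0, 0) & forall z, p z = p (0, 0)].
Proof.
move=> hw mom1 mom2.
have S1 := smooth_partial1; have S2 := smooth_partial2; have SC := @smooth_C1 R.
have [Su1 _] := slow_of_smooth su1 g11 g12.
have [Su2 _] := slow_of_smooth su2 g21 g22.
have Cw := C1B (SC _ (S2 _ _ su1)) (SC _ (S1 _ _ su2)).
have w0 : forall z, partial2 u1 z - partial1 u2 z = 0.
  move=> z; apply: (Liouville q1 (SC _ su1) (SC _ su2) du Su1 Su2 Cw
    (C1B (SC _ (S1 _ _ (S2 _ _ su1))) (SC _ (S1 _ _ (S1 _ _ su2))))
    (C1B (SC _ (S2 _ _ (S2 _ _ su1))) (SC _ (S2 _ _ (S1 _ _ su2))))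
    (vorticity_eq su1 su2 du sp mom1 mom2)).
  - by have [cw _ _ _ _] := Cw; exact: (cntO cw (cnt_powR_norm q1)).
  - by move=> n; exact: hw.
have W0 := C1_zero Cw w0.
have D0 := C1_zero (C1D (SC _ (S1 _ _ su1)) (SC _ (S2 _ _ su2))) du.
have lap1 z : partial1 (partial1 u1) z + partial2 (partial2 u1) z = 0.
  have [_ e1] := W0 z; have [e2 _] := D0 z.
  exact: (harmonic_algebra e2 (congr1 (fun g => g z) (partial_comm su2)) e1).
have lap2 z : partial1 (partial1 u2) z + partial2 (partial2 u2) z = 0.
  have [e1 _] := W0 z; have [_ e2] := D0 z.
  exact: (harmonic_algebra' e2 (congr1 (fun g => g z) (partial_comm su1)) e1).
have G1 := harmonic_grad_zero q1 su1 lap1 g11 g12.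
have G2 := harmonic_grad_zero q1 su2 lap2 g21 g22.
split.
- by apply: (C1_const (SC _ su1)) => z; have [] := G1 z.
- by apply: (C1_const (SC _ su2)) => z; have [] := G2 z.
- apply: (C1_const (SC _ sp)) => z; have [a1 a2] := G1 z; have [a3 a4] := G2 z.
    exact: (pressure_algebra (mom1 z) (lap1 z) a1 a2).
  exact: (pressure_algebra (mom2 z) (lap2 z) a3 a4).
Qed.

End Main.

Theorem theorem1p2 (R : realType) (q0 K L : R) (hq0 : 1 < q0)
    (hK : 0 <= K) (hL : 0 <= L) :
  exists2 eps : R, 0 < eps &
    forall (u b : R * R -> R * R) (p : R * R -> R),
      smooth_field u -> smooth_field b -> smooth p ->
      stationary_MHD u b p ->
      grad_norm u \in Lfun (lebesgue2 R) q0%:E ->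
      grad_norm b \in Lfun (lebesgue2 R) +oo%E ->
      Lpnorm q0%:E (grad_norm u) = K%:E ->
      Lpnorm +oo%E (grad_norm b) = L%:E ->
      (Lpnorm 1%E (enorm b)
        + Lpnorm 1%E (fun x => (`|current b x|%R `^ 3^-1)%R) <= eps%:E)%E ->
      [/\ exists c : R * R, forall x, u x = c,
          exists c : R, forall x, p x = c
        & forall x, b x = 0].
Proof.
(* The bound enters as integrability of b, so any positive value serves. *)
exists 1 => // u b p [su1 su2] [sb1 sb2] sp [mom1 mom2 ind1 ind2 du db] _ _ HK _ Hb.
have c11 := smooth_continuous (smooth_partial1 su1).
have c12 := smooth_continuous (smooth_partial2 su1).
have c21 := smooth_continuous (smooth_partial1 su2).
have c22 := smooth_continuous (smooth_partial2 su2).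
have cb1 := smooth_continuous sb1.
have cb2 := smooth_continuous sb2.
have cg : continuous (grad_norm u).
  have H := cnt_sqrt (cntD (cntD (cntD (@cntX _ _ _ 2%N c11) (@cntX _ _ _ 2%N c12))
    (@cntX _ _ _ 2%N c21)) (@cntX _ _ _ 2%N c22)).
  exact: H.
have g0 z : 0 <= grad_norm u z by exact: sqrtr_ge0.
have comp z := grad_component (partial1 (coord1 u) z) (partial2 (coord1 u) z)
  (partial1 (coord2 u) z) (partial2 (coord2 u) z).
have [M M0 HM] := Lpnorm_intg2 hq0 cg HK.
have le2 (f : R * R -> R) : continuous f -> (forall z, `|f z| <= 2 * grad_norm u z) ->
    forall a b c d, intg2 a b c d (fun z => `|f z| `^ q0) <= 2 `^ q0 * M.
  by move=> cf hf; exact: (intg2_powR_le hq0 cf cg g0 hf HM).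
have le1 z (s : R) : `|s| <= grad_norm u z -> `|s| <= 2 * grad_norm u z.
  by move=> /le_trans; apply; rewrite ler_peMl// ler1n.
have g11 : forall a b c d, intg2 a b c d (fun z => `|partial1 (coord1 u) z| `^ q0) <= 2 `^ q0 * M.
  by apply: le2; [assumption | move=> z; apply: le1; have [] := comp z].
have g12 : forall a b c d, intg2 a b c d (fun z => `|partial2 (coord1 u) z| `^ q0) <= 2 `^ q0 * M.
  by apply: le2; [assumption | move=> z; apply: le1; have [] := comp z].
have g21 : forall a b c d, intg2 a b c d (fun z => `|partial1 (coord2 u) z| `^ q0) <= 2 `^ q0 * M.
  by apply: le2; [assumption | move=> z; apply: le1; have [] := comp z].
have g22 : forall a b c d, intg2 a b c d (fun z => `|partial2 (coord2 u) z| `^ q0) <= 2 `^ q0 * M.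
  by apply: le2; [assumption | move=> z; apply: le1; have [] := comp z].
have gw : forall a b c d,
    intg2 a b c d (fun z => `|partial2 (coord1 u) z - partial1 (coord2 u) z| `^ q0) <= 2 `^ q0 * M.
  apply: (le2 _ (cntB c12 c21)) => z.
  have [_ h1 h2 _] := comp z; apply: (le_trans (ler_normB _ _)).
  by rewrite mulr2n mulrDl !mul1r; exact: lerD.
have ce : continuous (enorm b) by exact: (cnt_sqrt (cntD (@cntX _ _ _ 2%N cb1) (@cntX _ _ _ 2%N cb2))).
have He : (Lpnorm 1%E (enorm b) <= 1%:E)%E.
  by apply: le_trans Hb; rewrite leeDl// Lnorm_ge0.
have hb : forall x1 x2 y1 y2,
    intg2 x1 x2 y1 y2 (fun z => `|coord1 b z| + `|coord2 b z|) <= 2 * 1.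
  move=> x1 x2 y1 y2; apply: le_trans (ler_wpM2l (ler0n R 2) (L1norm_intg2 ce He x1 x2 y1 y2)).
  have cae := cntA ce.
  rewrite -(intg2Z x1 x2 y1 y2 2 cae); apply: intg2_le.
  - by apply: cntD; exact: cntA.
  - by apply: cntM => //; exact: cntC.
  - move=> x y _ _; have e : `|enorm b (x, y)| = enorm b (x, y).
      by apply: ger0_norm; exact: sqrtr_ge0.
    by rewrite e; exact: enorm_component.
have b0 := magnetic_field_zero hq0 su1 su2 sb1 sb2 du db g11 g12 g21 g22 hb ind1 ind2.
have bb x : advection b (coord1 b) x = 0 /\ advection b (coord2 b) x = 0.
  by rewrite /advection; have [-> ->] := b0 x; rewrite !mul0r addr0.
have [u1c u2c pc] := flow_constant hq0 su1 su2 sp du g11 g12 g21 g22 gw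
  (fun z => etrans (mom1 z) (proj1 (bb z))) (fun z => etrans (mom2 z) (proj2 (bb z))).
split.
- exists (u (0, 0)) => x; have := u1c x; have := u2c x; rewrite /coord1 /coord2.
  by case: (u x) (u (0, 0)) => [? ?] [? ?] /= -> ->.
- by exists (p (0, 0)).
- move=> x; have [] := b0 x; rewrite /coord1 /coord2.
  by case: (b x) => ? ? /= -> ->.
Qed.
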